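(* Let $\gamma=\{t+iy(t):t\in[a,b]\}$, $-\infty<a<b<\infty$, be the graph of a Lipschitz function $y:[a,b]\to\mathbb{R}$, and let $\varphi\not\equiv-\infty$ be a subharmonic function on $\mathbb{C}$. Then for a point $\gamma(t)\in\gamma$, $\nu(\varphi)(\gamma(t))<1$ if and only if $e^{-\varphi}$ is locally integrable (with respect to arc length $ds$ on $\gamma$) in a neighborhood of $\gamma(t)$ on $\gamma$.
   Context: The Lelong number of a subharmonic function $\varphi\not\equiv-\infty$ at $z\in\mathbb{C}$ is $\nu(\varphi)(z)=\lim_{r\to0^+}\frac{\max_{|\zeta-z|=r}\varphi(\zeta)}{\log r}$; equivalently it is the mass at the point $z$ of the measure $\frac{1}{2\pi}\Delta\varphi$. $\gamma(t)=t+iy(t)$. *)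

(* Defs.v *)
From HB Require Import structures.
From mathcomp Require Import all_boot all_order all_algebra.
From mathcomp Require Import all_classical all_reals all_analysis.
Set Implicit Arguments. Unset Strict Implicit. Unset Printing Implicit Defensive.
Import Order.TTheory GRing.Theory Num.Theory.
Import numFieldNormedType.Exports.
Local Open Scope classical_set_scope.
Local Open Scope ring_scope.

Section Defs.
Variable R : realType.

Definition circ (z : R * R) (r theta : R) : R * R :=
  (z.1 + r * cos theta, z.2 + r * sin theta).

Definition usc (phi : R * R -> \bar R) : Prop :=
  forall z (M : R), (phi z < M%:E)%E -> \forall w \near z, (phi w < M%:E)%E.

Definition subharmonic (phi : R * R -> \bar R) : Prop :=
  [/\ forall z, (phi z < +oo)%E,
      usc phi &
      forall z, exists2 r0 : R, 0 < r0 & forall r, 0 < r -> r < r0 ->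
        (phi z <= ((2 * pi)^-1)%R%:E *
           \int[@lebesgue_measure R]_(theta in `[0%R, (2 * pi)%R]) phi (circ z r theta))%E].

Definition circ_max (phi : R * R -> \bar R) (z : R * R) (r : R) : \bar R :=
  ereal_sup [set phi (circ z r theta) | theta in [set: R]].

Definition lelong (phi : R * R -> \bar R) (z : R * R) : \bar R :=
  lim ((fun r : R => (circ_max phi z r * ((ln r)^-1)%:E)%E) @ 0^'+).

Definition lipschitz_on_interval (y : R -> R) (a b : R) : Prop :=
  exists L : R, forall s t, a <= s <= b -> a <= t <= b -> `|y s - y t| <= L * `|s - t|.

Definition polylen (y : R -> R) (s : seq R) : R :=
  \sum_(i < (size s).-1)
     Num.sqrt ((s`_i.+1 - s`_i) ^+ 2 + (y s`_i.+1 - y s`_i) ^+ 2).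

Definition arclen (y : R -> R) (c d : R) : \bar R :=
  ereal_sup [set (polylen y s)%:E | s in
     [set s : seq R | [/\ s != [::], sorted <%R s, head 0 s = c & last 0 s = d]]].

Definition arclength_measure (y : R -> R) (a b : R)
    (mu : {measure set (measurableTypeR R) -> \bar R}) : Prop :=
  forall c d, a <= c -> c <= d -> d <= b -> mu `[c, d]%classic = arclen y c d.

End Defs.

(* Main.v *)
(* Both directions rest on the comparison principle for subharmonic functions
   against [A + c * \sum_j ln |z - w_j|^2] with [c >= 0], and no Riesz
   decomposition is needed.  With the single pole [w_0 = gamma t] it makes
   [M r = max_{|z - w_0| = r} phi z] convex in [ln r], so that the Lelong number
   is the infimum of the slopes of [M] between [r] and [1].  If it is at least
   [1], then [phi z <= M 1 + ln |z - w_0|], and [exp (- phi)] dominates a multiple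
   of [1 / |s - t|] along the curve.

   If some slope is below [m < 1], suppose that the set of parameters near [t]
   where [phi < - lam] has measure [l], and choose [n] points of it at mutual
   distance of order [l / n].  Comparing [phi] with the logarithmic potential of
   total mass [m] carried by these points, outside small discs around them on
   which [phi < - lam] still holds, contradicts the growth of [M] between [r] and
   [1] unless [l <= const * exp (- lam / m)].  Since [1 / m > 1], summing over the
   levels [lam = 0, 1, 2, ...] gives the integrability of [exp (- phi)]. *)
Require Import Defs.
From HB Require Import structures.
From mathcomp Require Import all_boot all_order all_algebra.
From mathcomp Require Import all_classical all_reals all_analysis.
From mathcomp Require Import measurable_realfun.
From mathcomp Require Import ring lra.
Import Order.TTheory GRing.Theory Num.Theory.
Import numFieldNormedType.Exports.
Local Open Scope classical_set_scope.
Local Open Scope ring_scope.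
Set Implicit Arguments. Unset Strict Implicit. Unset Printing Implicit Defensive.

(** * Maxima of upper semicontinuous functions on compact sets *)

(** The sets [B w] are nested because the order is total, so they generate a filter. A cluster point
    [p] of it is maximal, since [u p < u w] would give a neighbourhood of [p] that misses [B w].
    Values in any total order cover real and extended real functions at once. *)
Lemma usc_max (T : topologicalType) d (D : orderType d) (u : T -> D) (X : set T) :
  compact X -> X !=set0 ->
  (forall p w, X p -> X w -> (u p < u w)%O -> \forall z \near p, (u z < u w)%O) ->
  exists2 p, X p & forall w, X w -> (u w <= u p)%O.
Proof.
move=> cX [x0 Xx0] uscu.
pose B (w : T) := [set z | X z /\ (u w <= u z)%O].
pose F := filter_from X B.
have PF : ProperFilter F.
  apply: filter_from_proper; last by move=> w Xw; exists w; split.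
  apply: filter_from_filter; first by exists x0.
  move=> i j Xi Xj; case: (leP (u i) (u j)) => ij.
    exists j => // z [Xz jz]; split; split => //; exact: le_trans ij jz.
  exists i => // z [Xz jz]; split; split => //; exact: le_trans (ltW ij) jz.
have FX : F X by exists x0 => // z [].
have [p [Xp clp]] := cX F PF FX.
exists p => // w Xw; rewrite leNgt; apply/negP => puw.
have Fw : F (B w) by exists w.
have [z [[_ wz] zw]] := clp _ _ Fw (uscu p w Xp Xw puw).
by move: (le_lt_trans wz zw); rewrite ltxx.
Qed.

(** * Mean values over circles *)

(** The mean over [[0, 2 * pi]] is recorded through a primitive, so that means are computed by
    algebra and integrals enter only in [circ_mean_le]. *)
Definition has_mean (R : realType) (f : R -> R) (v : R) : Prop :=
  continuous f /\ exists2 F : R -> R, (forall x : R, is_derive x 1 F (f x)) &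
    F (2 * pi) - F 0 = 2 * pi * v.

Lemma has_mean_cst (R : realType) (k : R) : has_mean (fun=> k) k.
Proof.
split; first by move=> x; exact: cvg_cst.
exists (fun x => k * x); last by ring.
by move=> x; apply: is_derive_eq; rewrite /GRing.scale /=; ring.
Qed.

Lemma has_meanD (R : realType) (f g : R -> R) (v w : R) :
  has_mean f v -> has_mean g w -> has_mean (fun x => f x + g x) (v + w).
Proof.
move=> [cf [F dF Fv]] [cg [G dG Gw]]; split.
  by move=> x; apply: cvgD; [exact: cf|exact: cg].
exists (fun x => F x + G x); last by lra.
by move=> x; apply: is_deriveD.
Qed.

Lemma has_meanZ (R : realType) (f : R -> R) (k v : R) :
  has_mean f v -> has_mean (fun x => k * f x) (k * v).
Proof.
move=> [cf [F dF Fv]]; split.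
  by move=> x; apply: cvgM; [exact: cvg_cst|exact: cf].
exists (fun x => k * F x); last by rewrite -mulrBr Fv; ring.
move=> x; have := dF x => ?; exact: is_deriveZ.
Qed.

Lemma has_mean_trig (R : realType) (al be : R) :
  has_mean (fun x => al * cos x + be * sin x) 0.
Proof.
split.
  move=> x; apply: cvgD; apply: cvgM; try exact: cvg_cst;
    [exact: continuous_cos|exact: continuous_sin].
exists (fun x => al * sin x - be * cos x).
  by move=> x; apply: is_derive_eq; rewrite /GRing.scale /=; ring.
by rewrite /= mulr_natl cos2pi sin2pi cos0 sin0; ring.
Qed.

Lemma has_mean_trig2 (R : realType) (al be : R) :
  has_mean (fun x => (al * cos x + be * sin x) ^+ 2) ((al ^+ 2 + be ^+ 2) / 2).
Proof.
split.
  move=> x; have [c _] := has_mean_trig al be.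
  exact: (cvgM (c x) (c x)).
(* With [p] the trigonometric polynomial and [q] its derivative, [q' = - p] and
   [p^2 + q^2 = al^2 + be^2]; hence [(p q)' = q^2 - p^2], which yields this primitive of [p^2]. *)
exists (fun x => 2^-1 * ((al ^+ 2 + be ^+ 2) * x -
    (al * cos x + be * sin x) * (be * cos x - al * sin x))).
  move=> x; apply: is_derive_eq; rewrite /GRing.scale /=.
  have := cos2Dsin2 x => h.
  have -> : al ^+ 2 + be ^+ 2 = (al ^+ 2 + be ^+ 2) * (cos x ^+ 2 + sin x ^+ 2) by rewrite h mulr1.
  by field.
rewrite /= [in cos _]mulr_natl [in sin _]mulr_natl cos2pi sin2pi cos0 sin0.
by field.
Qed.

(** The difference of the two sides vanishes at [0] and has derivative [u^3 / (1 + u)], which has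
    the sign of [u]; the mean value theorem concludes on either side of [0]. *)
Lemma ln1D_le (R : realType) (x : R) : -1 < x ->
  ln (1 + x) <= x - x ^+ 2 / 2 + x ^+ 3 / 3.
Proof.
move=> x1.
pose g (u : R) := u - u ^+ 2 / 2 + u ^+ 3 / 3 - ln (1 + u).
pose dg (u : R) := u ^+ 3 / (1 + u).
have dgE (u : R) : -1 < u -> is_derive u 1 g (dg u).
  move=> u1; have u0 : 0 < 1 + u by lra.
  have := is_derive1_ln u0 => dln.
  have d1 : is_derive u (1:R) (fun v : R => ln (1 + v)) (1 + u)^-1.
    have := @is_derive1_comp _ (@ln R) (fun v => 1 + v) u _ 1 dln.
    rewrite mulr1; apply.
    by apply: is_derive_eq; rewrite add0r mul1r.
  rewrite /g /dg; apply: is_derive_eq; rewrite /GRing.scale /=.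
  by field; rewrite gt_eqF.
have cg (a b : R) : -1 < a -> {within `[a, b], continuous g}.
  move=> a1; apply: derivable_within_continuous => u; rewrite in_itv /= => /andP[au _].
  by have [] := dgE u (lt_le_trans a1 au).
have g0 : g 0 = 0 by rewrite /g addr0 ln1; ring.
suff : 0 <= g x by rewrite /g subr_ge0.
have [xlt|xgt|->] := ltgtP x 0; last by rewrite g0.
- have [u|c|c] := @MVT _ g dg x 0 xlt.
  + by rewrite in_itv /= => /andP[xu _]; apply: dgE; exact: lt_trans xu.
  + exact: cg.
  + rewrite in_itv /= => /andP[xc c0]; rewrite g0 => h.
    suff : dg c * (0 - x) <= 0 by rewrite -h; lra.
    have : dg c <= 0.
      rewrite /dg ler_pdivrMr ?mul0r; last by lra.
      by rewrite exprS mulr_le0_ge0 ?sqr_ge0 // ltW.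
    by move=> ?; nra.
- have [u|c|c] := @MVT _ g dg 0 x xgt.
  + by rewrite in_itv /= => /andP[xu _]; apply: dgE; lra.
  + by apply: cg; lra.
  + rewrite in_itv /= => /andP[xc c0]; rewrite g0 => h.
    suff : 0 <= dg c * (x - 0) by rewrite -h; lra.
    have : 0 <= dg c.
      by rewrite /dg divr_ge0 ?exprn_ge0 //; lra.
    by move=> ?; nra.
Qed.

Definition sqd (R : realType) (z w : R * R) : R :=
  (z.1 - w.1) ^+ 2 + (z.2 - w.2) ^+ 2.

Lemma sqd_ge0 (R : realType) (z w : R * R) : 0 <= sqd z w.
Proof. by rewrite addr_ge0 ?sqr_ge0. Qed.

Lemma sqd_circ (R : realType) (z w : R * R) (r x : R) :
  sqd (circ z r x) w =
  sqd z w + 2 * r * ((z.1 - w.1) * cos x + (z.2 - w.2) * sin x) + r ^+ 2.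
Proof.
rewrite /sqd /circ /=.
have -> : r ^+ 2 = r ^+ 2 * (cos x ^+ 2 + sin x ^+ 2) by rewrite cos2Dsin2 mulr1.
by ring.
Qed.

(* The third order expansion of the logarithm stands in for the exact mean
   value property: its error is negligible against the gain [e * r ^+ 2]
   obtained from adding [e * (x ^+ 2 + y ^+ 2)] to a subharmonic function. *)
Lemma ln_sqd_circ_le (R : realType) (z w : R * R) : 0 < sqd z w ->
  exists2 k : R, 0 <= k & forall r, 0 < r < 1 -> exists T v,
    [/\ has_mean T v, v <= k * r ^+ 3 &
      forall x, 0 < sqd (circ z r x) w -> ln (sqd (circ z r x) w) <= ln (sqd z w) + T x].
Proof.
set d := sqd z w => d0.
pose al := z.1 - w.1; pose be := z.2 - w.2.
(* For [r < 1] this gives [2 r p + r^2 <= B r], hence the upper bound [B / d * r] on the relative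
   increment [u] of the squared distance. *)
pose B := 2 * (`|al| + `|be|) + 1.
have B0 : 0 <= B by rewrite addr_ge0 // mulr_ge0 // addr_ge0.
exists ((B / d) ^+ 3 / 3); first by rewrite divr_ge0 // exprn_ge0 // divr_ge0 // ltW.
move=> r /andP[r0 r1].
pose p x := al * cos x + be * sin x.
have dE : d = al ^+ 2 + be ^+ 2 by [].
(* This is [u - u^2 / 2 + (B r / d)^3 / 3] with [u = (2 r p + r^2) / d], expanded in powers of [p].
   In its mean the terms [r^2 / d] and [- 2 r^2 / d^2] times [d / 2] cancel: the logarithm is
   harmonic to this order. *)
exists (fun x => (r ^+ 2 / d - r ^+ 4 / (2 * d ^+ 2) + (B / d) ^+ 3 / 3 * r ^+ 3) +
   ((2 * r / d - 2 * r ^+ 3 / d ^+ 2) * p x + (- 2 * r ^+ 2 / d ^+ 2) * (p x) ^+ 2)).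
exists ((r ^+ 2 / d - r ^+ 4 / (2 * d ^+ 2) + (B / d) ^+ 3 / 3 * r ^+ 3) +
   ((2 * r / d - 2 * r ^+ 3 / d ^+ 2) * 0 + (- 2 * r ^+ 2 / d ^+ 2) * (d / 2))).
split.
- apply: has_meanD; first exact: has_mean_cst.
  apply: has_meanD; apply: has_meanZ; first exact: has_mean_trig.
  exact: has_mean_trig2.
- rewrite -subr_ge0.
  have -> : (B / d) ^+ 3 / 3 * r ^+ 3 - (r ^+ 2 / d - r ^+ 4 / (2 * d ^+ 2) + (B / d) ^+ 3 / 3 * r ^+ 3 +
   ((2 * r / d - 2 * r ^+ 3 / d ^+ 2) * 0 + (- 2 * r ^+ 2 / d ^+ 2) * (d / 2)))
    = r ^+ 4 / (2 * d ^+ 2) by field; rewrite gt_eqF.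
  by rewrite divr_ge0 ?exprn_ge0 ?mulr_ge0 ?exprn_ge0 // ltW.
- move=> x; rewrite sqd_circ -/d -/al -/be -/(p x) => s0.
  pose u := (2 * r * p x + r ^+ 2) / d.
  have uE : d + 2 * r * p x + r ^+ 2 = d * (1 + u).
    by rewrite /u; field; rewrite gt_eqF.
  have u1 : 0 < 1 + u by move: s0; rewrite uE pmulr_rgt0.
  rewrite uE lnM ?posrE // lerD2l.
  apply: (le_trans (ln1D_le _)); first by lra.
  have ub : u <= B / d * r.
    rewrite /u (mulrAC B) ler_pM2r ?invr_gt0 //.
    have : p x <= `|al| + `|be|.
      apply: (le_trans (ler_norm _)); apply: (le_trans (ler_normD _ _)).
      rewrite !normrM lerD // ler_piMr //.
        by rewrite ler_norml cos_geN1 cos_le1.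
      by rewrite ler_norml sin_geN1 sin_le1.
    by rewrite /B; move: r0 r1; nra.
  have u3 : u ^+ 3 <= (B / d) ^+ 3 * r ^+ 3.
    have bd0 : 0 <= B / d * r by rewrite mulr_ge0 // ?divr_ge0 // ltW.
    rewrite -exprMn; have [u0|u0] := leP 0 u; first by rewrite lerXn2r // nnegrE.
    apply: (@le_trans _ _ 0); last by rewrite exprn_ge0.
    by rewrite exprS mulr_le0_ge0 ?sqr_ge0 // ltW.
  have -> : r ^+ 2 / d - r ^+ 4 / (2 * d ^+ 2) + (B / d) ^+ 3 / 3 * r ^+ 3 +
   ((2 * r / d - 2 * r ^+ 3 / d ^+ 2) * p x + (- 2 * r ^+ 2 / d ^+ 2) * p x ^+ 2)
   = u - u ^+ 2 / 2 + ((B / d) ^+ 3 * r ^+ 3) / 3.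
    by rewrite /u; field; rewrite gt_eqF.
  by rewrite lerD2l ler_pM2r // invr_gt0.
Qed.

Lemma sum_ln_sqd_circ_le (R : realType) (z : R * R) (ws : seq (R * R)) :
  (forall w, w \in ws -> 0 < sqd z w) ->
  exists2 k : R, 0 <= k & forall r, 0 < r < 1 -> exists T v,
    [/\ has_mean T v, v <= k * r ^+ 3 &
      forall x, (forall w, w \in ws -> 0 < sqd (circ z r x) w) ->
        \sum_(w <- ws) ln (sqd (circ z r x) w) <= \sum_(w <- ws) ln (sqd z w) + T x].
Proof.
elim: ws => [_|w ws IH h].
  exists 0 => // r _; exists (fun=> 0), 0; split; first exact: has_mean_cst.
    by rewrite mul0r.
  by move=> x _; rewrite !big_nil addr0.
have [k1 k10 H1] := ln_sqd_circ_le (h w (mem_head _ _)).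
have [|k2 k20 H2] := IH; first by move=> w' w'ws; apply: h; rewrite inE w'ws orbT.
exists (k1 + k2); first exact: addr_ge0.
move=> r r01; have [T1 [v1 [m1 l1 e1]]] := H1 _ r01.
have [T2 [v2 [m2 l2 e2]]] := H2 _ r01.
exists (fun x => T1 x + T2 x), (v1 + v2); split; first exact: has_meanD.
  by rewrite mulrDl lerD.
move=> x hx; rewrite !big_cons addrACA lerD //.
  by apply: e1; apply: hx; rewrite mem_head.
by apply: e2 => w' w'ws; apply: hx; rewrite inE w'ws orbT.
Qed.

Lemma circ_mean_le (R : realType) (f : R -> \bar R) (G : R -> R) (v : R) :
  measurable_fun setT f -> has_mean G v -> (forall x, (f x <= (G x)%:E)%E) ->
  (((2 * pi)^-1)%R%:E *
     \int[@lebesgue_measure R]_(x in `[0%R, (2 * pi)%R]) f x <= v%:E)%E.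
Proof.
move=> mf [cG [F dF Fv]] fG.
have pi0 : 0 < 2 * pi :> R by rewrite mulr_gt0 // pi_gt0.
have cGw : {within `[0, 2 * pi], continuous G} by exact: continuous_subspaceT.
have cF : continuous F.
  move=> x; apply: differentiable_continuous; apply/derivable1_diffP.
  by have [] := dF x.
have IG : (\int[@lebesgue_measure R]_(x in `[0%R, (2 * pi)%R]) (G x)%:E = (2 * pi * v)%:E)%E.
  rewrite (@continuous_FTC2 _ _ F _ _ pi0) // -?EFinB ?Fv //.
    split; first by move=> x _; have [] := dF x.
      by apply: cvg_at_right_filter; exact: cF.
    by apply: cvg_at_left_filter; exact: cF.
  by move=> x _; rewrite derive1E; have := dF x => ?; rewrite derive_val.
have -> : v%:E = (((2 * pi)^-1)%:E * (2 * pi * v)%:E)%E.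
  by rewrite -EFinM mulKf // gt_eqF.
apply: lee_wpmul2l; first by rewrite lee_fin invr_ge0 ltW.
have mf' : measurable_fun `[0, 2 * pi] f by exact: measurable_funTS.
have mG : measurable_fun `[0, 2 * pi] (EFin \o G).
  apply: measurable_funTS; apply/measurable_EFinP.
  exact: continuous_measurable_fun.
(* [f] may take the value [-oo] and its integral may be infinite, so positive and negative parts are
   compared separately. *)
rewrite -IG [leLHS]integralE [leRHS]integralE; apply: leeB; apply: ge0_le_integral => //;
  try exact: measurable_funepos; try exact: measurable_funeneg.
- by move=> x _; rewrite !unlock; apply: (le_max2 (fG x) (lexx _)).
- move=> x _; rewrite !unlock; apply: le_max2 => //; rewrite leeN2; exact: fG.
Qed.

(** * Comparison with logarithmic potentials *)

Lemma usc_lt (R : realType) (phi : R * R -> \bar R) (p : R * R) (e : \bar R) :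
  usc phi -> (phi p < e)%E -> \forall z \near p, (phi z < e)%E.
Proof.
move=> uphi; case: e => [M|pe|]; [exact: uphi| |by rewrite ltNge leNye].
have [M pM] : exists M : R, (phi p < M%:E)%E.
  move: pe; case: (phi p) => [r _|//|_]; last by exists 0; rewrite ltNyr.
  by exists (r + 1); rewrite lte_fin ltrDl.
by apply: filterS (uphi _ _ pM) => z /lt_le_trans; apply; rewrite leey.
Qed.

Lemma usc_measurable (R : realType) (phi : R * R -> \bar R) (g : R -> R * R) :
  usc phi -> continuous g -> measurable_fun setT (phi \o g).
Proof.
move=> uphi cg.
have -> : phi \o g = -%E \o (fun x => (- phi (g x))%E).
  by apply/funext => x /=; rewrite oppeK.
apply: measurableT_comp => //.
apply: lower_semicontinuous_measurable => x a; rewrite lteNr => h.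
exists [set y | (a%:E < - phi (g y))%E]; last by [].
have H : \forall y \near x, (phi (g y) < (- a)%:E)%E by exact: (cg x _ (uphi _ _ h)).
by apply: filterS H => y /=; rewrite lteNr.
Qed.

Lemma continuous_sqd (R : realType) (w : R * R) : continuous (fun z => sqd z w).
Proof.
move=> z; rewrite /sqd.
have c1 : (u.1 - w.1) @[u --> z] --> z.1 - w.1 by apply: cvgB; [exact: cvg_fst|exact: cvg_cst].
have c2 : (u.2 - w.2) @[u --> z] --> z.2 - w.2 by apply: cvgB; [exact: cvg_snd|exact: cvg_cst].
exact: (cvgD (cvgM c1 c1) (cvgM c2 c2)).
Qed.

Lemma continuous_circ (R : realType) (z : R * R) (r : R) : continuous (circ z r).
Proof.
move=> x; rewrite /circ.
apply: (@cvg_pair _ _ _ _ (nbhs (z.1 + r * cos x)) (nbhs (z.2 + r * sin x)));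
  apply: cvgD; try exact: cvg_cst;
  apply: cvgM; try exact: cvg_cst; [exact: continuous_cos|exact: continuous_sin].
Qed.

(** Since [ln (sqd z w)] is twice [ln |z - w|], each pole carries the Riesz mass [2 * c]. This
    accounts for the halved slopes and masses below. *)
Definition logpot (R : realType) (A c : R) (ws : seq (R * R)) (z : R * R) : R :=
  A + c * \sum_(w <- ws) ln (sqd z w).

Lemma logpot_continuous (R : realType) (A c : R) (ws : seq (R * R)) (z : R * R) :
  (forall w, w \in ws -> 0 < sqd z w) -> {for z, continuous (logpot A c ws)}.
Proof.
move=> h; rewrite /logpot; apply: cvgD; first exact: cvg_cst.
apply: cvgM; first exact: cvg_cst.
elim: ws h => [_|w ws IH h].
  by under eq_fun do rewrite big_nil; rewrite big_nil; exact: cvg_cst.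
under eq_fun do rewrite big_cons; rewrite big_cons; apply: cvgD; last first.
  by apply: IH => w' w'ws; apply: h; rewrite inE w'ws orbT.
apply: (@continuous_comp _ _ _ (fun z => sqd z w) (@ln R) z); first exact: continuous_sqd.
by apply: continuous_ln; apply: h; rewrite mem_head.
Qed.

Lemma usc_addr (R : realType) (phi : R * R -> \bar R) (g : R * R -> R) (p : R * R) (m : R) :
  usc phi -> {for p, continuous g} -> (phi p + (g p)%:E < m%:E)%E ->
  \forall z \near p, (phi z + (g z)%:E < m%:E)%E.
Proof.
move=> uphi cg h.
have [M pM Mg] : exists2 M : R, (phi p < M%:E)%E & g p < m - M.
  move: h; case: (phi p) => [r|//|_].
    rewrite -EFinD lte_fin => h; exists ((r + (m - g p)) / 2); rewrite ?lte_fin; lra.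
  by exists (m - g p - 1); [rewrite ltNyr|lra].
have := cg _ (lt_nbhsl Mg) => /= cg'.
near=> z.
have -> : m%:E = (M%:E + (m - M)%:E)%E by rewrite -EFinD addrC subrK.
apply: lteD; first by near: z; exact: uphi.
by rewrite lte_fin; near: z; exact: cg'.
Unshelve. all: by end_near. Qed.

Lemma nbhs_circ (R : realType) (z : R * R) (X : set (R * R)) : nbhs z X ->
  exists2 e : R, 0 < e & forall r x, 0 < r -> r < e -> X (circ z r x).
Proof.
move=> /nbhs_ballP[e /= e0 H]; exists e => // r x r0 re; apply: H.
split; rewrite /ball /= /circ /= opprD addNKr normrN normrM gtr0_norm //;
  apply: le_lt_trans re; apply: ler_piMr; try exact: ltW.
- by rewrite ler_norml cos_geN1 cos_le1.
- by rewrite ler_norml sin_geN1 sin_le1.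
Qed.

(** Maximum principle for [phi - h + eps |z|^2], with [h] the potential. At a maximum point where
    [X] is a neighbourhood, the mean over a small circle gains [eps r^2] from the quadratic term and
    loses only [O(r^3)] from [h], which contradicts maximality. At any other point the bound is
    given. *)
Lemma comparison (R : realType) (phi : R * R -> \bar R) (X : set (R * R))
    (A c : R) (ws : seq (R * R)) :
  subharmonic phi -> compact X -> 0 <= c ->
  (forall z w, X z -> w \in ws -> 0 < sqd z w) ->
  (forall z, X z -> (phi z <= (logpot A c ws z)%:E)%E \/ nbhs z X) ->
  forall z, X z -> (phi z <= (logpot A c ws z)%:E)%E.
Proof.
move=> [phioo uphi submean] cX c0 Xws bd z1 Xz1.
pose o : R * R := (0, 0); pose q z := sqd z o.
have [zQ XzQ hQ] : exists2 zQ, X zQ & forall w, X w -> q w <= q zQ.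
  apply: usc_max => //; first by exists z1.
  by move=> p w Xp Xw pw; have := @continuous_sqd R o p _ (lt_nbhsl pw).
set Q := q zQ in hQ.
have Q0 : 0 <= Q := sqd_ge0 _ _.
apply/lee_addgt0Pr => e e0.
(* Keeps [eps |z|^2 <= e] on [X], so that the perturbation costs at most [e]; the [+ 1] covers
   [Q = 0]. *)
pose eps := e / (Q + 1).
have eps0 : 0 < eps by rewrite divr_gt0 // ltr_wpDl.
have epsQ : eps * Q <= e.
  rewrite /eps mulrAC ler_pdivrMr; last by lra.
  by rewrite ler_pM2l //; lra.
pose h := logpot A c ws.
pose g z := eps * q z - h z.
pose u z := (phi z + (g z)%:E)%E.
have cg z : X z -> {for z, continuous g}.
  move=> Xz; apply: cvgB.
    by apply: cvgM; [exact: cvg_cst|exact: continuous_sqd].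
  by apply: logpot_continuous => w; exact: Xws.
have [p Xp pmax] : exists2 p, X p & forall w, X w -> (u w <= u p)%E.
  apply: usc_max => //; first by exists z1.
  move=> p w Xp Xw; rewrite /u; case E : (phi w) => [r||]; last 2 first.
  - by have := phioo w; rewrite E.
  - by rewrite addNye ltNge leNye.
  - by move=> ?; apply: usc_addr => //; exact: cg.
have uz1 := pmax _ Xz1.
have [hp|np] := bd p Xp.
  have up : (u p <= (eps * Q)%:E)%E.
    apply: (@le_trans _ _ ((h p)%:E + (g p)%:E)%E); first exact: leeD.
    rewrite -EFinD lee_fin /g addrC subrK ler_pM2l //; exact: hQ.
  have {up}uz1 := le_trans uz1 up.
  move: uz1; rewrite /u /g; case: (phi z1) (phioo z1) => [r|//|] _.
    rewrite -!EFinD !lee_fin -/h.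
    have : 0 <= eps * q z1 by rewrite mulr_ge0 ?sqd_ge0 // ltW.
    by lra.
  by move=> _; rewrite leNye.
case E : (phi p) => [v0||]; last 2 first.
- by have := phioo p; rewrite E.
- move: uz1; rewrite /u E addNye leeNy_eq => /eqP.
  by case: (phi z1) => // _; rewrite leNye.
exfalso.
have [r0 r00 sm] := submean p.
have [k k0 Hk] := @sum_ln_sqd_circ_le R p ws (fun w => Xws p w Xp).
have [e1 e10 He1] := nbhs_circ np.
(* Below [r0] the sub-mean inequality holds, below [e1] the circle stays in [X], below [1] the
   expansion of the logarithms is valid, and below [eps / (c * k + 1)] the gain [eps r^2] exceeds
   the error [c k r^3]. *)
pose r := Num.min (Num.min (r0 / 2) (e1 / 2)) (Num.min (1 / 2) (eps / (c * k + 1) / 2)).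
have ck0 : 0 <= c * k by exact: mulr_ge0.
have ek0 : 0 < eps / (c * k + 1) by rewrite divr_gt0 // ltr_wpDl.
have rpos : 0 < r by rewrite /r !lt_min; apply/andP; split; apply/andP; split; lra.
have rr0 : r < r0 by rewrite /r !gt_min; apply/orP; left; apply/orP; left; lra.
have re1 : r < e1 by rewrite /r !gt_min; apply/orP; left; apply/orP; right; lra.
have r1 : r < 1 by rewrite /r !gt_min; apply/orP; right; apply/orP; left; lra.
have rk : r < eps / (c * k + 1) by rewrite /r !gt_min; apply/orP; right; apply/orP; right; lra.
have [|T [v [mT vk HT]]] := Hk r; first by rewrite rpos.
pose pp x := (p.1 - o.1) * cos x + (p.2 - o.2) * sin x.
(* Maximality of [p] bounds [phi] on the circle by [v0 + g p - g]. Replacing the logarithms in [g]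
   by [T] leaves this function, of mean [v0 - eps r^2 + c v < v0]. *)
have mG := has_meanD (has_mean_cst (v0 - eps * r ^+ 2))
  (has_meanD (has_meanZ c mT) (has_meanZ (- (2 * eps * r)) (has_mean_trig (p.1 - o.1) (p.2 - o.2)))).
have := le_trans (sm r rpos rr0) (circ_mean_le (f := phi \o circ p r) _ mG _).
have mc : measurable_fun setT (phi \o circ p r).
  by apply: usc_measurable => //; exact: continuous_circ.
have le x : (phi (circ p r x) <= (v0 - eps * r ^+ 2 +
    (c * T x + - (2 * eps * r) * pp x))%:E)%E.
  have Xc := He1 r x rpos re1.
  have := pmax _ Xc; rewrite /u E.
  case: (phi (circ p r x)) => [s||]; rewrite ?leNye //.
  rewrite -!EFinD !lee_fin /g /q sqd_circ -/(pp x) -/(q p) /h /logpot.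
  have := HT x (fun w => Xws _ w Xc); set S1 := \sum_(_ <- _) _; set S2 := \sum_(_ <- _) _.
  move=> S12; have : c * S1 <= c * (S2 + T x) by rewrite ler_wpM2l.
  by lra.
move=> /(_ mc le); rewrite E lee_fin => hh.
have : c * v <= c * k * r ^+ 3 by rewrite -mulrA ler_wpM2l.
have : eps * r ^+ 2 > c * k * r ^+ 3.
  have r2 : 0 < r ^+ 2 by rewrite exprn_gt0.
  rewrite exprSr mulrA [ltLHS]mulrAC ltr_pM2r //.
  move: rk; rewrite ltr_pdivlMr; last lra.
  by move: rpos ck0; nra.
by move=> a1 a2; lra.
Qed.

(** * Growth of the maximum over circles *)

Lemma compact_disc (R : realType) (z0 : R * R) (R2 : R) : compact [set z | sqd z z0 <= R2].
Proof.
have [R20|R20] := ltP R2 0.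
  have -> : [set z | sqd z z0 <= R2] = set0; last exact: compact0.
  by rewrite -subset0 => z /=; have := sqd_ge0 z z0; lra.
pose I (x : R) := `[x - (R2 + 1), x + (R2 + 1)]%classic.
apply: (@subclosed_compact _ _ (I z0.1 `*` I z0.2)).
- apply: (@closed_comp _ _ (fun z => sqd z z0) [set x | x <= R2]); last exact: closed_le.
  by move=> z _; exact: continuous_sqd.
- by apply: compact_setX; exact: segment_compact.
- move=> [x1 x2] /=; rewrite /sqd /= => h.
  have := sqr_ge0 (x1 - z0.1); have := sqr_ge0 (x2 - z0.2) => h1 h2.
  by split; rewrite /I /= in_itv /=; nra.
Qed.

Lemma near_all_seq (T : eqType) (U : topologicalType) (z : U) (ws : seq T) (P : T -> U -> Prop) :
  (forall w, w \in ws -> \forall x \near z, P w x) ->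
  \forall x \near z, forall w, w \in ws -> P w x.
Proof.
elim: ws => [_|w ws IH h]; first exact: nearW.
have H1 := h w (mem_head _ _).
have H2 : \forall x \near z, forall w, w \in ws -> P w x.
  by apply: IH => w' w'ws; apply: h; rewrite inE w'ws orbT.
near=> x => w'; rewrite inE => /orP[/eqP ->|]; first by near: x.
by move: w'; near: x.
Unshelve. all: by end_near. Qed.

(** Here [X] is a closed disc with open discs about the poles removed. Where all its inequalities
    are strict, [X] is a neighbourhood by continuity, so only the outer circle and the circles about
    the poles call for a bound. *)
Lemma disc_comparison (R : realType) (phi : R * R -> \bar R) (z0 : R * R)
    (R2 k A c : R) (ws : seq (R * R)) :
  subharmonic phi -> 0 <= c -> 0 < k ->
  (forall z, sqd z z0 = R2 -> (forall w, w \in ws -> k <= sqd z w) ->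
     (phi z <= (logpot A c ws z)%:E)%E) ->
  (forall z w, w \in ws -> sqd z w = k -> sqd z z0 <= R2 ->
     (forall w', w' \in ws -> k <= sqd z w') -> (phi z <= (logpot A c ws z)%:E)%E) ->
  forall z, sqd z z0 <= R2 -> (forall w, w \in ws -> k <= sqd z w) ->
    (phi z <= (logpot A c ws z)%:E)%E.
Proof.
move=> sphi c0 k0 hR hk z hz hw.
pose X := [set z | sqd z z0 <= R2] `&` \bigcap_(w in [set w | w \in ws]) [set z | k <= sqd z w].
apply: (comparison (X := X)) => //.
- apply: (@subclosed_compact _ _ [set z | sqd z z0 <= R2]); last 2 first.
  + exact: compact_disc.
  + by move=> ? [].
  apply: closedI; last first.
    apply: closed_bigI => w _.
    apply: (@closed_comp _ _ (fun z => sqd z w) [set x | k <= x]); last exact: closed_ge.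
    by move=> ? _; exact: continuous_sqd.
  apply: (@closed_comp _ _ (fun z => sqd z z0) [set x | x <= R2]); last exact: closed_le.
  by move=> ? _; exact: continuous_sqd.
- by move=> u w [_ h] wws; apply: lt_le_trans k0 _; exact: h.
- move=> u [/= uR uk]; have [uR2|uR2] := eqVneq (sqd u z0) R2.
    by left; apply: hR => // w wws; exact: uk.
  have [/hasP[w wws /eqP uw]|/hasPn nk] := boolP (has (fun w => sqd u w == k) ws).
    by left; apply: (hk u w) => // w' w'ws; exact: uk.
  right.
  have uR2' : sqd u z0 < R2 by rewrite lt_neqAle uR2.
  have n1 : \forall x \near u, sqd x z0 < R2 := @continuous_sqd _ z0 u _ (lt_nbhsl uR2').
  have n2 : \forall x \near u, forall w, w \in ws -> k < sqd x w.
    apply: near_all_seq => w wws.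
    have uw : k < sqd u w by rewrite lt_neqAle eq_sym nk //=; exact: uk.
    exact: (@continuous_sqd _ w u _ (lt_nbhsr uw)).
  near=> x; split => /=; first by apply/ltW; near: x.
  by move=> w wws; apply/ltW; move: w wws; near: x.
Unshelve. all: by end_near. Qed.

Lemma circ_surj (R : realType) (z0 z : R * R) (r : R) : 0 < r -> sqd z z0 = r ^+ 2 ->
  exists x, z = circ z0 r x.
Proof.
move=> r0 h; pose a := (z.1 - z0.1) / r; pose b := (z.2 - z0.2) / r.
have ab : a ^+ 2 + b ^+ 2 = 1.
  by rewrite /a /b !expr_div_n -mulrDl -/(sqd z z0) h divff // expf_neq0 // gt_eqF.
have a1 : -1 <= a <= 1 by have := sqr_ge0 b => ?; apply/andP; split; nra.
have zE x : cos x = a -> sin x = b -> z = circ z0 r x.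
  move=> ca sb; rewrite /circ ca sb /a /b ![r * _]mulrC !divfK ?gt_eqF //.
  by rewrite ![_ + (_ - _)]addrC !subrK; case: (z).
have b2 : Num.sqrt (1 - a ^+ 2) = `|b|.
  by rewrite -ab addrAC subrr add0r sqrtr_sqr.
have [b0|b0] := leP 0 b.
  exists (acos a); apply: zE; first by rewrite acosK // in_itv.
  by rewrite sin_acos // b2 ger0_norm.
exists (- acos a); apply: zE; first by rewrite cosN acosK // in_itv.
by rewrite sinN sin_acos // b2 ltr0_norm // opprK.
Qed.

Lemma sqdzz (R : realType) (z : R * R) : sqd z z = 0.
Proof. by rewrite /sqd !subrr expr0n /= addr0. Qed.

Lemma sqd_circ_center (R : realType) (z0 : R * R) (r x : R) : sqd (circ z0 r x) z0 = r ^+ 2.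
Proof. by rewrite sqd_circ sqdzz !subrr; ring. Qed.

Lemma circ_max_ub (R : realType) (phi : R * R -> \bar R) (z0 z : R * R) (r : R) :
  0 < r -> sqd z z0 = r ^+ 2 -> (phi z <= circ_max phi z0 r)%E.
Proof.
move=> r0 /(circ_surj r0)[x ->]; apply: ereal_sup_ubound.
by exists x.
Qed.

Lemma circ_max_le (R : realType) (phi : R * R -> \bar R) (z0 : R * R) (r : R) (e : \bar R) :
  (forall z, sqd z z0 = r ^+ 2 -> (phi z <= e)%E) -> (circ_max phi z0 r <= e)%E.
Proof.
move=> h; apply: ge_ereal_sup => _ [x _ <-]; apply: h; exact: sqd_circ_center.
Qed.

Lemma circ_max_lty (R : realType) (phi : R * R -> \bar R) (z0 : R * R) (r : R) :
  subharmonic phi -> (circ_max phi z0 r < +oo)%E.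
Proof.
move=> [phioo uphi _]; pose X := [set z | sqd z z0 = r ^+ 2].
have [|||p _ pmax] := @usc_max _ _ _ phi X.
- apply: (@subclosed_compact _ _ [set z | sqd z z0 <= r ^+ 2]); last 2 first.
  + exact: compact_disc.
  + by move=> z /= ->.
  apply: (@closed_comp _ _ (fun z => sqd z z0) [set r ^+ 2]); last exact: closed_eq.
  by move=> ? _; exact: continuous_sqd.
- by exists (circ z0 r 0); exact: sqd_circ_center.
- by move=> p w _ _; exact: usc_lt.
by apply: le_lt_trans (phioo p); apply: circ_max_le => z hz; exact: pmax.
Qed.

Lemma lee_EFin_ub (R : realType) (x e : \bar R) : (e < +oo)%E ->
  (forall A : R, (e <= A%:E)%E -> (x <= A%:E)%E) -> (x <= e)%E.
Proof.
case: e => [r _ h|//|_ h]; first exact: h.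
by rewrite (@eq_ninfty _ x) // => A; apply: h; rewrite leNye.
Qed.

Lemma circ_max_disc (R : realType) (phi : R * R -> \bar R) (z0 z : R * R) (r : R) :
  subharmonic phi -> 0 < r -> sqd z z0 <= r ^+ 2 -> (phi z <= circ_max phi z0 r)%E.
Proof.
move=> sphi r0 zr; apply: lee_EFin_ub; first exact: circ_max_lty.
move=> A hA.
(* A constant is a potential without poles, so this is the ordinary maximum principle. *)
have -> : A = logpot A 0 [::] z by rewrite /logpot mul0r addr0.
apply: (@disc_comparison _ _ z0 (r ^+ 2) 1) => // u ur _.
rewrite /logpot mul0r addr0; apply: le_trans hA; exact: circ_max_ub.
Qed.

Lemma three_circles (R : realType) (phi : R * R -> \bar R) (z0 z : R * R) (r1 r2 A c : R) :
  subharmonic phi -> 0 < r1 -> 0 < r2 -> 0 <= c ->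
  (circ_max phi z0 r1 <= (A + c * ln (r1 ^+ 2))%:E)%E ->
  (circ_max phi z0 r2 <= (A + c * ln (r2 ^+ 2))%:E)%E ->
  r1 ^+ 2 <= sqd z z0 <= r2 ^+ 2 ->
  (phi z <= (A + c * ln (sqd z z0))%:E)%E.
Proof.
move=> sphi r10 r20 c0 h1 h2 /andP[z1 z2].
have hE u : logpot A c [:: z0] u = A + c * ln (sqd u z0) by rewrite /logpot big_seq1.
rewrite -hE; apply: (@disc_comparison _ _ z0 (r2 ^+ 2) (r1 ^+ 2)) => //.
- by rewrite exprn_gt0.
- move=> u ur _; rewrite hE ur; apply: le_trans h2; exact: circ_max_ub.
- move=> u w; rewrite inE => /eqP -> ur _ _; rewrite hE ur.
  by apply: le_trans h1; exact: circ_max_ub.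
- by move=> w; rewrite inE => /eqP ->.
Qed.

(** If the maximum were [-oo], then [phi] would be [-oo] inside the circle. Outside, the inner
    condition of [three_circles] would hold for every coefficient, so that arbitrarily steep
    potentials would push [phi z] below any bound. *)
Lemma circ_max_gtNy (R : realType) (phi : R * R -> \bar R) (z0 : R * R) (r : R) :
  subharmonic phi -> ~ (forall z, phi z = -oo%E) -> 0 < r -> (-oo < circ_max phi z0 r)%E.
Proof.
move=> sphi nphi r0; rewrite ltNye; apply/eqP => M; apply: nphi => z.
have [zr|zr] := leP (sqd z z0) (r ^+ 2).
  by apply/eqP; rewrite -leeNy_eq -M; exact: circ_max_disc.
set s := sqd z z0 in zr.
have s0 : 0 < s by apply: lt_trans zr; rewrite exprn_gt0.
pose r2 := Num.sqrt (s + 1).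
have r20 : 0 < r2 by rewrite sqrtr_gt0; lra.
have r22 : r2 ^+ 2 = s + 1 by rewrite sqr_sqrtr //; lra.
have [B hB] : exists B : R, (circ_max phi z0 r2 <= B%:E)%E.
  have := circ_max_lty z0 r2 sphi; case: circ_max => [B _|//|_]; first by exists B.
  by exists 0; rewrite leNye.
have ls : 0 < ln (s + 1) - ln s by rewrite subr_gt0 ltr_ln ?posrE //; lra.
apply: eq_ninfty => A.
(* The steepness that takes the potential from [B] at squared radius [s + 1] down to at most [A] at
   squared radius [s]. *)
pose c := Num.max 0 (B - A) / (ln (s + 1) - ln s).
have c0 : 0 <= c by rewrite divr_ge0 ?le_max ?lexx // ltW.
have := @three_circles _ phi z0 z r r2 (B - c * ln (s + 1)) c sphi r0 r20 c0.
rewrite M r22 leNye subrK -/s => /(_ isT hB) => h.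
apply: le_trans (h _) _; first by apply/andP; split; lra.
rewrite lee_fin.
have -> : B - c * ln (s + 1) + c * ln s = B - c * (ln (s + 1) - ln s) by ring.
rewrite /c divfK ?gt_eqF //.
have : B - A <= Num.max 0 (B - A) by rewrite le_max lexx orbT.
by lra.
Qed.

(** * Slopes of the circle maximum and the Lelong number *)

(** The chord slope, in the variable [ln r], between the radii [r] and [1]; at radius [1] the
    logarithm vanishes. For [r > 0] and [phi] not identically [-oo], both maxima are finite and
    [fine] loses nothing. *)
Definition circ_slope (R : realType) (phi : R * R -> \bar R) (z0 : R * R) (r : R) : R :=
  (fine (circ_max phi z0 1) - fine (circ_max phi z0 r)) / (- ln r).

Lemma circ_maxE (R : realType) (phi : R * R -> \bar R) (z0 : R * R) (r : R) :
  subharmonic phi -> ~ (forall z, phi z = -oo%E) -> 0 < r ->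
  circ_max phi z0 r = (fine (circ_max phi z0 r))%:E.
Proof.
move=> sphi nphi r0; rewrite fineK // fin_numElt circ_max_gtNy //=.
exact: circ_max_lty.
Qed.

Lemma circ_slope_ge0 (R : realType) (phi : R * R -> \bar R) (z0 : R * R) (r : R) :
  subharmonic phi -> ~ (forall z, phi z = -oo%E) -> 0 < r < 1 ->
  0 <= circ_slope phi z0 r.
Proof.
move=> sphi nphi /andP[r0 r1].
rewrite divr_ge0 //; last by rewrite oppr_ge0 ln_le0 // ltW.
rewrite subr_ge0 -lee_fin -!circ_maxE //.
apply: circ_max_le => z zr; apply: circ_max_disc => //.
by rewrite zr expr1n expr_le1 // ltW.
Qed.

(** The one-pole potential that interpolates the circle maximum at the radii [r] and [1]; the slope
    is halved because [sqd] is a squared distance. *)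
Lemma phi_le_slope (R : realType) (phi : R * R -> \bar R) (z0 z : R * R) (r : R) :
  subharmonic phi -> ~ (forall z, phi z = -oo%E) -> 0 < r < 1 ->
  r ^+ 2 <= sqd z z0 <= 1 ->
  (phi z <= (fine (circ_max phi z0 1) + circ_slope phi z0 r / 2 * ln (sqd z z0))%:E)%E.
Proof.
move=> sphi nphi r01 zr; have /andP[r0 r1] := r01.
have l0 : ln r < 0 by rewrite ln_lt0 // r0.
apply: (@three_circles _ _ _ _ r 1) => //.
- by rewrite divr_ge0 // circ_slope_ge0.
- rewrite circ_maxE // lee_fin lnXn // /circ_slope -mulr_natl.
  rewrite le_eqVlt; apply/orP; left; apply/eqP.
  by field; rewrite lt_eqF.
- by rewrite expr1n ln1 mulr0 addr0 -circ_maxE.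
- by rewrite expr1n.
Qed.

Lemma circ_slope_nondecreasing (R : realType) (phi : R * R -> \bar R) (z0 : R * R) :
  subharmonic phi -> ~ (forall z, phi z = -oo%E) ->
  {in `]0, 1[ &, {homo circ_slope phi z0 : r s / r <= s}}.
Proof.
move=> sphi nphi r s; rewrite !in_itv /= => r01 s01 rs.
have /andP[r0 r1] := r01; have /andP[s0 s1] := s01.
have ls : ln s < 0 by rewrite ln_lt0 // s0.
rewrite [leRHS]/circ_slope ler_pdivlMr ?oppr_gt0 //.
suff : fine (circ_max phi z0 s) <= fine (circ_max phi z0 1) + circ_slope phi z0 r / 2 * ln (s ^+ 2).
  by rewrite lnXn // -mulr_natl; lra.
rewrite -lee_fin -circ_maxE //; apply: circ_max_le => z zs; rewrite -zs.
apply: phi_le_slope => //; rewrite zs ler_pXn2r ?nnegrE ?(ltW r0) ?(ltW s0) //.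
by rewrite rs /= expr_le1 // ltW.
Qed.

Lemma circ_slope_lb (R : realType) (phi : R * R -> \bar R) (z0 : R * R) :
  subharmonic phi -> ~ (forall z, phi z = -oo%E) ->
  has_lbound (circ_slope phi z0 @` `]0, 1[%classic).
Proof.
move=> sphi nphi; exists 0 => _ [r /= + <-]; rewrite in_itv /=.
exact: circ_slope_ge0.
Qed.

(** The quotient defining the Lelong number is the slope plus [N 1 / ln r]. The second term tends to
    [0], and the slope, being monotone and bounded below, tends to its infimum; in particular the
    limit exists. *)
Lemma lelongE (R : realType) (phi : R * R -> \bar R) (z0 : R * R) :
  subharmonic phi -> ~ (forall z, phi z = -oo%E) ->
  lelong phi z0 = (inf (circ_slope phi z0 @` `]0, 1[%classic))%:E.
Proof.
move=> sphi nphi; apply/cvg_lim => //.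
set nu := inf _; pose N r := fine (circ_max phi z0 r).
have cs : circ_slope phi z0 r @[r --> 0^'+] --> nu.
  apply: (@nondecreasing_at_right_cvgr _ _ _ (BLeft 1)) => //.
    by rewrite bnd_simp.
    exact: circ_slope_nondecreasing.
  exact: circ_slope_lb.
have cl : N 1 * (ln r)^-1 @[r --> 0^'+] --> N 1 * 0.
  apply: cvgM; first exact: cvg_cst.
  apply/ltr0_cvgV0; last exact: lnNy.
  near=> r; rewrite ln_lt0 //; apply/andP; split; first by near: r; exact: nbhs_right_gt.
  by near: r; exact: nbhs_right_lt.
have E : \forall r \near 0^'+, (circ_max phi z0 r * ((ln r)^-1)%:E =
    (N 1 * (ln r)^-1 + circ_slope phi z0 r)%:E)%E.
  near=> r.
  have r0 : 0 < r by near: r; exact: nbhs_right_gt.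
  have r1 : r < 1 by near: r; exact: nbhs_right_lt.
  rewrite circ_maxE // -EFinM; congr EFin; rewrite /circ_slope -/(N 1) -/(N r).
  by field; rewrite lt_eqF // ln_lt0 // r0.
apply/fine_cvgP; split.
  by apply: filterS E => r ->.
have -> : nu = N 1 * 0 + nu by rewrite mulr0 add0r.
apply: cvg_trans (cvgD cl cs); apply: near_eq_cvg.
by apply: filterS E => r /= ->.
Unshelve. all: by end_near. Qed.

Lemma lelong_lt1 (R : realType) (phi : R * R -> \bar R) (z0 : R * R) :
  subharmonic phi -> ~ (forall z, phi z = -oo%E) -> (lelong phi z0 < 1)%E ->
  exists2 r, 0 < r < 1 & circ_slope phi z0 r < 1.
Proof.
move=> sphi nphi; rewrite lelongE // lte_fin => /inf_lt[|_ [r /= + <-] h].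
  by exists (circ_slope phi z0 2^-1), 2^-1 => //=; rewrite in_itv /=; apply/andP; split; lra.
by rewrite in_itv /=; exists r.
Qed.

(** Apply the slope bound with [r] the distance from [z] to [z0]. The slope is at least [1] and
    [ln (sqd z z0)] is negative, so replacing the slope by [1] only raises the bound. *)
Lemma lelong_ge1 (R : realType) (phi : R * R -> \bar R) (z0 : R * R) :
  subharmonic phi -> ~ (forall z, phi z = -oo%E) -> ~ (lelong phi z0 < 1)%E ->
  forall z, 0 < sqd z z0 < 1 ->
    (phi z <= (fine (circ_max phi z0 1) + ln (sqd z z0) / 2)%:E)%E.
Proof.
move=> sphi nphi; rewrite lelongE // => /negP; rewrite -leNgt lee_fin => h z /andP[z0' z1].
have l0 : ln (sqd z z0) < 0 by rewrite ln_lt0 // z0'.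
pose r := Num.sqrt (sqd z z0).
have r2 : r ^+ 2 = sqd z z0 by rewrite sqr_sqrtr // ltW.
have r0 : 0 < r by rewrite sqrtr_gt0.
have r1 : r < 1 by rewrite -(@ltr_pXn2r _ 2) ?nnegrE ?ltW // r2 expr1n.
have s1 : 1 <= circ_slope phi z0 r.
  apply: le_trans h _; apply: ge_inf; first exact: circ_slope_lb.
  by exists r => //=; rewrite in_itv /= r0.
have hr : 0 < r < 1 by rewrite r0.
have hz : r ^+ 2 <= sqd z z0 <= 1 by rewrite r2 lexx ltW.
by apply: le_trans (phi_le_slope sphi nphi hr hz) _; rewrite lee_fin; nra.
Qed.

(** * Arc length and spaced points *)

Lemma polylen_cons (R : realType) (y : R -> R) (x x' : R) (s : seq R) :
  polylen y (x :: x' :: s) =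
  Num.sqrt ((x' - x) ^+ 2 + (y x' - y x) ^+ 2) + polylen y (x' :: s).
Proof. by rewrite /polylen /= big_ord_recl. Qed.

Lemma path_lt_last (R : realType) (x : R) (s : seq R) : path <%R x s -> x <= last x s.
Proof.
elim: s x => [|x' s IH] x //= /andP[xx' p]; exact: le_trans (ltW xx') (IH _ p).
Qed.

Lemma polylen_le (R : realType) (y : R -> R) (a b L x : R) (s : seq R) :
  (forall s t, a <= s <= b -> a <= t <= b -> `|y s - y t| <= L * `|s - t|) ->
  a <= x -> path <%R x s -> last x s <= b ->
  polylen y (x :: s) <= (1 + `|L|) * (last x s - x).
Proof.
move=> lip; elim: s x => [|x' s IH] x ax.
  by move=> _ _; rewrite /= subrr mulr0 /polylen big_ord0.
move=> /= /andP[xx' p] lb; have x'l := path_lt_last p.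
rewrite polylen_cons.
have : polylen y (x' :: s) <= (1 + `|L|) * (last x' s - x') by apply: IH => //; lra.
have ax' : a <= x' <= b by apply/andP; split; lra.
have axb : a <= x <= b by apply/andP; split; lra.
have dx : 0 < x' - x by lra.
have dy : `|y x' - y x| <= `|L| * (x' - x).
  apply: le_trans (lip _ _ ax' axb) _; rewrite (gtr0_norm dx) ler_wpM2r ?ler_norm //; exact: ltW.
suff : Num.sqrt ((x' - x) ^+ 2 + (y x' - y x) ^+ 2) <= (1 + `|L|) * (x' - x) by lra.
have ge : 0 <= (1 + `|L|) * (x' - x) by rewrite mulr_ge0 // ?(ltW dx) // addr_ge0.
rewrite -(ger0_norm ge) -sqrtr_sqr ler_wsqrtr //.
rewrite -[(y x' - y x) ^+ 2]real_normK ?num_real //.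
have : `|y x' - y x| ^+ 2 <= (`|L| * (x' - x)) ^+ 2.
  by rewrite ler_pXn2r ?nnegrE // mulr_ge0 // ltW.
rewrite !exprMn; have := normr_ge0 L; have : 0 < (x' - x) ^+ 2 by rewrite exprn_gt0.
by set u := (x' - x) ^+ 2; set v := _ ^+ 2; nra.
Qed.

(** Arc length enters the proof through this bound and the next one: the upper bound serves the
    integrability, the lower bound the divergence. *)
Lemma arclen_le (R : realType) (y : R -> R) (a b L c d : R) :
  (forall s t, a <= s <= b -> a <= t <= b -> `|y s - y t| <= L * `|s - t|) ->
  a <= c -> d <= b -> (arclen y c d <= ((1 + `|L|) * (d - c))%:E)%E.
Proof.
move=> lip ac db; apply: ge_ereal_sup => _ [[|x s] [//= _ p xc ld] <-].
rewrite lee_fin -{}ld -{}xc in ac db *.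
exact: polylen_le lip ac p db.
Qed.

Lemma arclen_ge (R : realType) (y : R -> R) (c d : R) :
  c <= d -> ((d - c)%:E <= arclen y c d)%E.
Proof.
(* Chains are strictly increasing, so for [c = d] the one-point chain is used in place of the
   chord. *)
rewrite le_eqVlt => /orP[/eqP <-|cd]; apply: ereal_sup_ge.
  exists 0%:E; last by rewrite subrr.
  by exists [:: c] => //; rewrite /polylen big_ord0.
exists (polylen y [:: c; d])%:E; first by exists [:: c; d] => //=; split; rewrite ?cd.
rewrite lee_fin polylen_cons /polylen big_ord0 addr0.
have dc : 0 <= d - c by lra.
rewrite -{1}(ger0_norm dc) -sqrtr_sqr ler_wsqrtr // lerDl sqr_ge0 //.
Qed.

Definition spaced (R : realType) (eta : R) (x y : R) : bool := x + eta <= y.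

(** Greedy choice: take a point within [eta] of the infimum and discard the part of [E] within
    [2 * eta] of the infimum. This costs measure at most [2 * C * eta], and what remains lies at
    least [eta] beyond the chosen point. The last point only requires positive measure, hence [n.+1]
    points. *)
Lemma spaced_points (R : realType) (a b C eta : R)
    (mu : {measure set (measurableTypeR R) -> \bar R}) (n : nat) (E : set (measurableTypeR R)) :
  0 <= C -> 0 < eta ->
  (forall c d, a <= c -> c <= d -> d <= b -> (mu `[c, d]%classic <= (C * (d - c))%:E)%E) ->
  measurable E -> E `<=` `[a, b]%classic -> ((2 * C * eta * n%:R)%:E < mu E)%E ->
  exists s : seq R, [/\ size s = n.+1, sorted (spaced eta) s & forall x, x \in s -> E x].
Proof.
move=> C0 eta0 muC; elim: n E => [|n IH] E mE Eab hE.
  have /set0P[x Ex] : E != set0.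
    by apply/eqP => E0; move: hE; rewrite E0 measure0 lte_fin mulr0 ltxx.
  by exists [:: x]; split => // u; rewrite inE => /eqP ->.
have E0 : E !=set0.
  apply/set0P/eqP => E0; move: hE; rewrite E0 measure0 lte_fin ltNge mulr_ge0 //.
  by rewrite mulr_ge0 // ?(ltW eta0) // mulr_ge0.
have lE : has_lbound E by exists a => x /Eab /=; rewrite in_itv /= => /andP[].
have iE : has_inf E by split.
set sg := inf E; have asg : a <= sg.
  apply: lb_le_inf => // x /Eab /=; by rewrite in_itv /= => /andP[].
have [x Ex xsg] := inf_adherent eta0 iE; rewrite -/sg in xsg.
have xb : x <= b by move: (Eab _ Ex); rewrite /= in_itv /= => /andP[].
have sgx : sg <= x by apply: ge_inf.
(* Cut at [b], since the measure bound is available only inside [[a, b]]. *)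
pose d := Num.min b (sg + 2 * eta).
pose J : set (measurableTypeR R) := `[sg, d]%classic.
have mJ : measurable J by exact: measurable_itv.
have sd : sg <= d by rewrite /d le_min; apply/andP; split; lra.
have db : d <= b by rewrite /d ge_min lexx.
have de : d - sg <= 2 * eta.
  have : d <= sg + 2 * eta by rewrite /d ge_min lexx orbT.
  by lra.
have muJ : (mu J <= (2 * C * eta)%:E)%E.
  by apply: le_trans (muC _ _ asg sd db) _; rewrite lee_fin; nra.
have [|||s [ss sts sE]] := IH (E `\` J).
- exact: measurableD.
- by move=> u [/Eab].
- rewrite ltNge; apply/negP => le.
  have : (mu E <= mu (E `\` J) + mu J)%E.
    apply: le_trans (_ : (mu ((E `\` J) `|` J) <= _)%E).
      apply: le_measure; rewrite ?inE //; first by apply: measurableU => //; exact: measurableD.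
      by move=> u Eu; have [Ju|Ju] := pselect (J u); [right|left].
    by apply: measureU2 => //; exact: measurableD.
  move=> /(lt_le_trans hE); rewrite ltNge => /negP; apply.
  apply: le_trans (leeD le muJ) _.
  by rewrite -EFinD lee_fin -natr1; lra.
exists (x :: s); split; first by rewrite /= ss.
  case: s ss sts sE => [//|u s] _ sts sE; rewrite /= in sts *; rewrite sts andbT /spaced.
  have [Eu nJu] := sE u (mem_head _ _).
  have su : sg <= u by apply: ge_inf.
  have ub : u <= b by move: (Eab _ Eu); rewrite /= in_itv /= => /andP[].
  suff : sg + 2 * eta < u by lra.
  rewrite ltNge; apply/negP => ule; apply: nJu.
  by rewrite /J /= in_itv /= su /d le_min ub ule.
by move=> u; rewrite inE => /orP[/eqP ->//|/sE []].
Qed.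

(** * Logarithmic sums over spaced points *)

Lemma spaced_last (R : realType) (eta x : R) (s : seq R) :
  path (spaced eta) x s -> x + (size s)%:R * eta <= last x s.
Proof.
elim: s x => [|u s IH] x /=; first by rewrite mul0r addr0.
move=> /andP[xu /IH]; rewrite /spaced in xu; rewrite -natr1; lra.
Qed.

(** The induction step from [N] to [N + 1] amounts to [N * ln (1 + 1 / N) <= 1]. *)
Lemma ln_fact_ge (R : realType) (n : nat) : n%:R * ln n%:R - n%:R <= ln (n`!)%:R :> R.
Proof.
elim: n => [|n IH]; first by rewrite mul0r subr0 fact0 ln1.
rewrite factS natrM lnM ?posrE ?ltr0n ?fact_gt0 //.
case: n IH => [|n] IH; first by rewrite fact0 !ln1; lra.
set N : R := n.+1%:R in IH *.
have N0 : 0 < N by rewrite ltr0n.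
have V0 : 0 < N^-1 by rewrite invr_gt0.
have NV : N * N^-1 = 1 by rewrite divff ?gt_eqF.
have -> : n.+2%:R = N + 1 :> R by rewrite /N natr1.
have -> : ln (N + 1) = ln N + ln (1 + N^-1).
  by rewrite -lnM ?posrE ?addr_gt0 // mulrDr mulr1 NV.
have hl : ln (1 + N^-1) <= N^-1 by apply: le_ln1Dx; apply: lt_trans V0; lra.
have := ler_wpM2l (ltW N0) hl; rewrite NV.
by lra.
Qed.

(** The [k]-th point after [w] is at distance at least [k * eta] from it, and the terms [ln k] add
    up to the logarithm of a factorial. The halved spacing leaves room for evaluating the potential
    not at [w] itself but at distance [eta / 2] from it. *)
Lemma spaced_right_sum (R : realType) (eta w : R) (s : seq R) (f : R -> R) :
  0 < eta -> path (spaced eta) w s ->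
  (forall u k, u \in s -> (0 < k)%N -> w + k%:R * eta <= u ->
     2 * ln (k%:R * (eta / 2)) <= f u) ->
  2 * (ln ((size s)`!)%:R + (size s)%:R * ln (eta / 2)) <= \sum_(u <- s) f u.
Proof.
move=> eta0; elim/last_ind: s => [|s u IH] p h.
  by rewrite big_nil fact0 ln1 mul0r addr0 mulr0.
have eta2 : 0 < eta / 2 by lra.
have := p; rewrite rcons_path => /andP[ps su].
rewrite -cats1 big_cat big_seq1 /= cats1 size_rcons factS.
have {}IH : 2 * (ln ((size s)`!)%:R + (size s)%:R * ln (eta / 2)) <= \sum_(v <- s) f v.
  by apply: IH => // v k vs; apply: h; rewrite mem_rcons inE vs orbT.
have hu : 2 * ln ((size s).+1%:R * (eta / 2)) <= f u.
  apply: h => //; first by rewrite mem_rcons mem_head.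
  by have := spaced_last p; rewrite size_rcons last_rcons.
move: hu IH; rewrite natrM !lnM ?posrE ?ltr0n ?fact_gt0 //.
by rewrite -natr1; lra.
Qed.

Lemma spaced_left_sum (R : realType) (eta w : R) (s : seq R) (f : R -> R) :
  0 < eta -> sorted (spaced eta) (rcons s w) ->
  (forall u k, u \in s -> (0 < k)%N -> u + k%:R * eta <= w ->
     2 * ln (k%:R * (eta / 2)) <= f u) ->
  2 * (ln ((size s)`!)%:R + (size s)%:R * ln (eta / 2)) <= \sum_(u <- s) f u.
Proof.
move=> eta0; elim: s => [|u s IH] p h.
  by rewrite big_nil fact0 ln1 mul0r addr0 mulr0.
have eta2 : 0 < eta / 2 by lra.
rewrite big_cons factS [size _]/=.
have {}IH : 2 * (ln ((size s)`!)%:R + (size s)%:R * ln (eta / 2)) <= \sum_(u <- s) f u.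
  apply: IH; first exact: path_sorted p.
  by move=> v k vs; apply: h; rewrite inE vs orbT.
have hu : 2 * ln ((size s).+1%:R * (eta / 2)) <= f u.
  apply: h => //; first by rewrite mem_head.
  by have := spaced_last p; rewrite size_rcons last_rcons.
move: hu IH; rewrite natrM !lnM ?posrE ?ltr0n ?fact_gt0 //.
by rewrite -natr1; lra.
Qed.

Lemma bin_le_exp2 (n m : nat) : ('C(n, m) <= 2 ^ n)%N.
Proof.
elim: n m => [[|m]//|n IH [|m]]; first by rewrite bin0 expn_gt0.
by rewrite binS expnS mul2n -addnn leq_add.
Qed.

(* Among the products of distances inside a spaced family of [N] points, the
   middle points have the smallest one, [(N/2)!^2]; bounding the binomial
   coefficient by [2 ^ N] keeps the leading term [N ln (N eta)] sharp. *)
Lemma spaced_sum_ge (R : realType) (eta w : R) (s : seq R) (n : nat) (f : R -> R) :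
  0 < eta -> sorted (spaced eta) s -> size s = n.+1 -> w \in s ->
  2 * ln (eta / 2) <= f w ->
  (forall u k, u \in s -> (0 < k)%N -> k%:R * eta <= `|u - w| ->
     2 * ln (k%:R * (eta / 2)) <= f u) ->
  2 * n.+1%:R * (ln (n.+1%:R * eta) - 4) <= \sum_(u <- s) f u.
Proof.
move=> eta0 ss sn ws fw h.
have eta2 : 0 < eta / 2 by lra.
move: ws ss sn h => /splitPr[s1 s2] ss sn h.
have tr : transitive (spaced eta) by rewrite /spaced => a b c; lra.
have p1 : sorted (spaced eta) (rcons s1 w).
  apply: (subseq_sorted tr _ ss); rewrite -cat_rcons; exact: prefix_subseq.
have p2 : path (spaced eta) w s2.
  exact: (subseq_sorted tr (suffix_subseq s1 (w :: s2)) ss).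
have r1 : 2 * (ln ((size s1)`!)%:R + (size s1)%:R * ln (eta / 2)) <= \sum_(u <- s1) f u.
  apply: (@spaced_left_sum _ _ w) => // u k us k0 uk; apply: h => //.
    by rewrite mem_cat us.
  by rewrite distrC; apply: le_trans (ler_norm _); lra.
have r2 : 2 * (ln ((size s2)`!)%:R + (size s2)%:R * ln (eta / 2)) <= \sum_(u <- s2) f u.
  apply: (@spaced_right_sum _ _ w) => // u k us k0 uk; apply: h => //.
    by rewrite mem_cat inE us !orbT.
  by apply: le_trans (ler_norm _); lra.
rewrite big_cat big_cons /=.
move: sn; rewrite size_cat /= addnS => -[sn].
set n1 := size s1 in r1 sn *; set n2 := size s2 in r2 sn *.
have bin : ln (n`!)%:R <= n%:R * ln 2 + ln (n1`!)%:R + ln (n2`!)%:R :> R.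
  have := @bin_fact n n1; rewrite -sn leq_addr addKn => /(_ isT) <-.
  rewrite !natrM !lnM ?posrE ?ltr0n ?muln_gt0 ?fact_gt0 ?bin_gt0 ?leq_addr //.
  rewrite addrA !lerD2r mulr_natl -lnXn // -natrX ler_ln ?posrE ?ltr0n ?expn_gt0 ?bin_gt0 ?leq_addr //.
  by rewrite ler_nat bin_le_exp2.
(* The loss of [4] per point: at most [1] for [ln 2] in [ln (eta / 2)], [1] for the binomial
   coefficient, [1] for the bound on the factorial, and [1] for [ln N <= N - 1] in passing from [N!]
   to [n!]. *)
have hf := ln_fact_ge R n.+1.
have hS : ln (n.+1`!)%:R = ln n.+1%:R + ln (n`!)%:R :> R.
  by rewrite factS natrM lnM // posrE ltr0n // fact_gt0.
have l2 : ln 2 <= 1 :> R by have := @le_ln1Dx R 1; rewrite -[1 + 1]/(2 : R); apply; lra.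
set N : R := n.+1%:R in hf hS *.
have N0 : 0 < N by rewrite ltr0n.
have nN : n%:R = N - 1 :> R by rewrite /N -natr1 addrK.
have n12 : n1%:R + n2%:R = N - 1 :> R by rewrite -natrD sn.
have lN : ln N <= N - 1.
  by have := @le_ln1Dx R (N - 1); rewrite [1 + _]addrC subrK; apply; lra.
have le2 : ln (eta / 2) = ln eta - ln 2 by rewrite lnM ?posrE ?invr_gt0 // lnV ?posrE.
rewrite lnM ?posrE // nN in bin *.
have : (n1%:R + n2%:R) * ln (eta / 2) = (N - 1) * ln (eta / 2) by rewrite n12.
have : N * ln 2 <= N * 1 by rewrite ler_pM2l.
have l20 : 0 < ln 2 :> R by apply: ln_gt0; lra.
by rewrite le2 in fw r1 r2 *; lra.
Qed.

(** * Level sets along the curve *)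

(** Both coordinates of [z - z0] are at most [1] in absolute value, so the cross term is at most
    [4 * rho]. *)
Lemma sqd_perturb (R : realType) (z z0 w : R * R) (rho : R) :
  sqd z z0 <= 1 -> `|w.1 - z0.1| <= rho -> `|w.2 - z0.2| <= rho ->
  sqd z z0 - 4 * rho <= sqd z w <= sqd z z0 + 4 * rho + 2 * rho ^+ 2.
Proof.
rewrite !ler_norml => z1 /andP[a1 a2] /andP[b1 b2].
pose dx := z.1 - z0.1; pose dy := z.2 - z0.2.
pose e1 := w.1 - z0.1; pose e2 := w.2 - z0.2.
have zw : sqd z w = sqd z z0 - 2 * (dx * e1 + dy * e2) + (e1 ^+ 2 + e2 ^+ 2).
  by rewrite /sqd /dx /dy /e1 /e2; ring.
have hd : dx ^+ 2 + dy ^+ 2 <= 1 by [].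
rewrite zw; move: a1 a2 b1 b2; rewrite -/e1 -/e2 => a1 a2 b1 b2.
have dx1 : -1 <= dx <= 1 by have := sqr_ge0 dy => ?; apply/andP; split; nra.
have dy1 : -1 <= dy <= 1 by have := sqr_ge0 dx => ?; apply/andP; split; nra.
move: dx1 dy1 => /andP[? ?] /andP[? ?].
have : - rho <= dx * e1 <= rho by apply/andP; split; nra.
have : - rho <= dy * e2 <= rho by apply/andP; split; nra.
have : e1 ^+ 2 <= rho ^+ 2 by nra.
have : e2 ^+ 2 <= rho ^+ 2 by nra.
have := sqr_ge0 e1; have := sqr_ge0 e2.
by move=> ? ? ? ? /andP[? ?] /andP[? ?]; apply/andP; split; lra.
Qed.

Lemma sqd_ge_fst (R : realType) (z w : R * R) (d : R) :
  0 <= d -> d <= `|z.1 - w.1| -> d ^+ 2 <= sqd z w.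
Proof.
move=> d0 h; rewrite /sqd; have := sqr_ge0 (z.2 - w.2).
have : d ^+ 2 <= `|z.1 - w.1| ^+ 2 by rewrite ler_pXn2r ?nnegrE.
by rewrite real_normK ?num_real //; lra.
Qed.

(** If the bound failed, the potential of total mass [m] spread evenly over the points would
    dominate [phi] on the unit circle and on the circles of radius [eta / 2] about the poles, where
    [phi <= - lam]. By comparison it would do so on the circle of radius [r], making the growth from
    [r] to [1] too large. *)
Lemma level_points (R : realType) (phi : R * R -> \bar R) (z0 : R * R)
    (r rho m lam eta : R) (g : R -> R * R) (s : seq R) (n : nat) :
  let N1 := fine (circ_max phi z0 1) in
  subharmonic phi -> ~ (forall z, phi z = -oo%E) ->
  0 < r < 1 -> 0 < rho -> 0 < m -> 0 < eta -> (eta / 2) ^+ 2 <= r ^+ 2 - 4 * rho ->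
  N1 - fine (circ_max phi z0 r) < m / 2 * (ln (1 - 4 * rho) - ln (r ^+ 2 + 6 * rho)) ->
  (forall u, (g u).1 = u) ->
  (forall u, u \in s -> `|(g u).1 - z0.1| <= rho /\ `|(g u).2 - z0.2| <= rho) ->
  sorted (spaced eta) s -> size s = n.+1 ->
  (forall u z, u \in s -> sqd z (g u) = (eta / 2) ^+ 2 -> (phi z <= (- lam)%:E)%E) ->
  ln (n.+1%:R * eta) < 4 + ln (1 - 4 * rho) / 2 - (lam + N1) / m.
Proof.
move=> N1 sphi nphi r01 rho0 m0 eta0 er hN g1 grho ss sn phis.
have /andP[r0 r1] := r01.
have eta2 : 0 < eta / 2 by lra.
have e2 : 0 < (eta / 2) ^+ 2 by rewrite exprn_gt0.
have r21 : r ^+ 2 < 1 by rewrite expr_lt1 // ltW.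
have al0 : 0 < 1 - 4 * rho by lra.
rewrite ltNge; apply/negP => hlam.
pose N : R := n.+1%:R.
have N0 : 0 < N by rewrite ltr0n.
(* The total Riesz mass [2 * c * N] is [m]. On the unit circle every pole is at squared distance at
   least [1 - 4 * rho], so this [A] makes the potential at least [N1] there. *)
pose c := m / (2 * N); pose A := N1 - m / 2 * ln (1 - 4 * rho).
have c0 : 0 <= c by rewrite divr_ge0 ?mulr_ge0 // ltW.
have cN : c * N = m / 2 by rewrite /c; field; rewrite gt_eqF.
have hE z : logpot A c (map g s) z = A + c * \sum_(u <- s) ln (sqd z (g u)).
  by rewrite /logpot big_map.
have sumc (k : R) : \sum_(u <- s) k = N * k.
  by rewrite big_const_seq count_predT sn iter_addr_0 mulr_natl.
have cmp : forall z, sqd z z0 <= 1 -> (forall w, w \in map g s -> (eta / 2) ^+ 2 <= sqd z w) ->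
    (phi z <= (logpot A c (map g s) z)%:E)%E.
  apply: disc_comparison => //.
  - move=> z zz0 _.
    have : (phi z <= circ_max phi z0 1)%E by apply: circ_max_ub; rewrite // expr1n.
    rewrite circ_maxE // => /le_trans; apply; rewrite hE lee_fin -/N1.
    have : N * ln (1 - 4 * rho) <= \sum_(u <- s) ln (sqd z (g u)).
      rewrite -sumc big_seq [leRHS]big_seq; apply: ler_sum => u us.
      have [gr1 gr2] := grho u us.
      have zz1 : sqd z z0 <= 1 by rewrite zz0.
      have /andP[lo _] := sqd_perturb zz1 gr1 gr2; rewrite zz0 in lo.
      rewrite ler_ln ?posrE //; exact: lt_le_trans lo.
    by move=> /(ler_wpM2l c0); rewrite mulrA cN /A; lra.
  - move=> z _ /mapP[w ws ->] zw _ _.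
    apply: le_trans (phis w z ws zw) _; rewrite hE lee_fin.
    have : 2 * n.+1%:R * (ln (n.+1%:R * eta) - 4) <= \sum_(u <- s) ln (sqd z (g u)).
      apply: (@spaced_sum_ge _ eta w) => //.
        by rewrite zw lnXn // mulr_natl.
      move=> u k us k0 kw.
      (* Horizontally [z] is within [eta / 2] of [w], hence at least
         [(k - 1 / 2) * eta >= k * (eta / 2)] away from [u], as [k >= 1]. *)
      have k1 : 1 <= k%:R :> R by rewrite ler1n.
      have ke : 0 < k%:R * (eta / 2) by rewrite mulr_gt0 // ltr0n.
      have zwf : `|z.1 - w| <= eta / 2.
        rewrite -(ler_pXn2r (n := 2)) ?nnegrE // ?(ltW eta2) // -zw real_normK ?num_real //.
        by rewrite /sqd g1 lerDl sqr_ge0.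
      rewrite mulr_natl -lnXn // ler_ln ?posrE ?exprn_gt0 //.
        apply: sqd_ge_fst; rewrite ?(ltW ke) // g1.
        have := ler_distD z.1 u w; rewrite [`|u - z.1|]distrC.
        by nra.
      apply: lt_le_trans (_ : (k%:R * (eta / 2)) ^+ 2 <= _); first by rewrite exprn_gt0.
      apply: sqd_ge_fst; rewrite ?(ltW ke) // g1.
      have := ler_distD z.1 u w; rewrite [`|u - z.1|]distrC.
      by nra.
    move=> /(ler_wpM2l c0).
    have -> : c * (2 * n.+1%:R * (ln (n.+1%:R * eta) - 4)) = m * (ln (n.+1%:R * eta) - 4).
      by rewrite [2 * _]mulrC !mulrA cN; field.
    have : m * (4 + ln (1 - 4 * rho) / 2 - (lam + N1) / m) <= m * ln (n.+1%:R * eta).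
      by rewrite ler_pM2l.
    have -> : m * (4 + ln (1 - 4 * rho) / 2 - (lam + N1) / m) =
       4 * m + m / 2 * ln (1 - 4 * rho) - (lam + N1) by field; rewrite gt_eqF.
    by rewrite /A; lra.
(* On this circle the squared distances to the poles are at most [r^2 + 4 rho + 2 rho^2], which is
   below [r^2 + 6 rho] because [rho < 1]. *)
suff : fine (circ_max phi z0 r) <= A + m / 2 * ln (r ^+ 2 + 6 * rho).
  by rewrite /A; lra.
rewrite -lee_fin -circ_maxE //; apply: circ_max_le => z zr.
have zp u : u \in s -> r ^+ 2 - 4 * rho <= sqd z (g u) <= r ^+ 2 + 4 * rho + 2 * rho ^+ 2.
  move=> us; have [gr1 gr2] := grho u us.
  by rewrite -zr; apply: sqd_perturb => //; rewrite zr ltW.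
apply: le_trans (cmp z _ _) _.
- by rewrite zr ltW.
- by move=> _ /mapP[u us ->]; have /andP[+ _] := zp u us; exact: le_trans.
- rewrite hE lee_fin lerD2l -cN -mulrA ler_wpM2l // -sumc big_seq [leRHS]big_seq; apply: ler_sum => u us.
  have /andP[lo hi] := zp u us.
  have lo0 : 0 < sqd z (g u) by apply: lt_le_trans lo; lra.
  rewrite ler_ln ?posrE //; last by have := exprn_gt0 2 r0; lra.
  by nra.
Qed.

Lemma nbhs_sqd (R : realType) (w : R * R) (P : set (R * R)) : nbhs w P ->
  exists2 e : R, 0 < e & forall z, sqd z w < e ^+ 2 -> P z.
Proof.
move=> /nbhs_ballP[e /= e0 H]; exists e => // z zw; apply: H.
have h (d : R) : d ^+ 2 <= sqd z w -> `|d| < e.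
  move=> dz; rewrite -(ltr_pXn2r (n := 2)) ?nnegrE ?(ltW e0) //.
  by rewrite real_normK ?num_real //; apply: le_lt_trans zw.
split; rewrite /ball /= distrC; apply: h; rewrite /sqd.
  by rewrite lerDl sqr_ge0.
by rewrite lerDr sqr_ge0.
Qed.

Lemma measure_bigcup_le (R : realType) (mu : {measure set (measurableTypeR R) -> \bar R})
    (E : (set (measurableTypeR R))^nat) (B : \bar R) :
  (forall k, measurable (E k)) -> nondecreasing_seq E -> (forall k, (mu (E k) <= B)%E) ->
  (mu (\bigcup_k E k) <= B)%E.
Proof.
move=> mE ndE h.
have cv := @nondecreasing_cvg_mu _ _ _ mu _ mE (bigcup_measurable (fun k _ => mE k)) ndE.
rewrite -(cvg_lim _ cv) //; apply: lime_le; first by apply/cvg_ex; eexists; exact: cv.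
exact: nearW.
Qed.

(** The bound obtained from [level_points] does not involve the spacing [eta], which may therefore
    be as small as the discs around the points of [E k] require. *)
Lemma level_measure (R : realType) (phi : R * R -> \bar R) (z0 : R * R)
    (r rho m lam a b C : R) (g : R -> R * R)
    (mu : {measure set (measurableTypeR R) -> \bar R}) (I : set (measurableTypeR R)) :
  let N1 := fine (circ_max phi z0 1) in
  subharmonic phi -> ~ (forall z, phi z = -oo%E) ->
  0 < r < 1 -> 0 < rho -> 0 < m -> 0 < r ^+ 2 - 4 * rho ->
  N1 - fine (circ_max phi z0 r) < m / 2 * (ln (1 - 4 * rho) - ln (r ^+ 2 + 6 * rho)) ->
  continuous g -> (forall u, (g u).1 = u) -> 0 <= C ->
  (forall c d, a <= c -> c <= d -> d <= b -> (mu `[c, d]%classic <= (C * (d - c))%:E)%E) ->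
  measurable I -> I `<=` `[a, b]%classic ->
  (forall u, I u -> `|(g u).1 - z0.1| <= rho /\ `|(g u).2 - z0.2| <= rho) ->
  (mu (I `&` [set u | (phi (g u) < (- lam)%:E)%E]) <=
     (2 * C * expR (4 + ln (1 - 4 * rho) / 2 - (lam + N1) / m))%:E)%E.
Proof.
move=> N1 sphi nphi r01 rho0 m0 er hN cg g1 C0 muC mI Iab Irho.
have [_ uphi _] := sphi.
pose d k : R := k.+1%:R^-1.
have d0 k : 0 < d k by rewrite invr_gt0 ltr0n.
(* Asking for [phi < - lam] on a whole disc makes [E k] the part of [I] outside a union of open
   sets, hence measurable; upper semicontinuity makes the [E k] exhaust the level set. *)
pose E k : set (measurableTypeR R) :=
  I `&` [set u | forall z, sqd z (g u) < d k ^+ 2 -> (phi z < (- lam)%:E)%E].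
have mE k : measurable (E k).
  apply: measurableI => //.
  pose O := \bigcup_(z in [set z | ((- lam)%:E <= phi z)%E]) [set u | sqd z (g u) < d k ^+ 2].
  have -> : [set u | forall z, sqd z (g u) < d k ^+ 2 -> (phi z < (- lam)%:E)%E] = ~` O.
    apply/seteqP; split=> u /=.
      by move=> h [z /= hz /h]; rewrite ltNge hz.
    move=> h z zu; rewrite ltNge; apply/negP => hz; apply: h; by exists z.
  apply: measurableC; apply: open_measurable; apply: bigcup_open => z _.
  apply: (@open_comp _ _ (fun u => sqd z (g u)) [set x | x < d k ^+ 2]); last exact: open_lt.
  move=> u _; have sqdC v w : sqd v w = sqd w v :> R by rewrite /sqd; ring.
  under eq_fun do rewrite sqdC.
  apply: (@continuous_comp _ _ _ g (fun v => sqd v z)); first exact: cg.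
  exact: continuous_sqd.
have -> : I `&` [set u | (phi (g u) < (- lam)%:E)%E] = \bigcup_k E k.
  apply/seteqP; split=> u.
    move=> [Iu /= hu]; have [e e0 he] := nbhs_sqd (uphi _ _ hu).
    have e10 : 0 <= e^-1 by rewrite invr_ge0 ltW.
    exists (Num.bound e^-1) => //; split => // z zu; apply: he; apply: lt_trans zu _.
    rewrite ltr_pXn2r ?nnegrE ?(ltW e0) ?(ltW (d0 _)) // /d.
    rewrite invf_plt ?posrE ?ltr0n //; apply: lt_trans (archi_boundP e10) _.
    by rewrite ltr_nat.
  by move=> [k _ [Iu h]]; split => //=; apply: h; rewrite sqdzz exprn_gt0.
apply: measure_bigcup_le => //.
  move=> i j ij; apply/subsetPset => u [Iu h]; split => // z zu; apply: h.
  apply: lt_le_trans zu _; rewrite ler_pXn2r ?nnegrE ?(ltW (d0 _)) // /d.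
  by rewrite lef_pV2 ?posrE ?ltr0n // ler_nat ltnS.
move=> k; rewrite leNgt; apply/negP => hlt.
set B := expR _ in hlt.
have B0 : 0 < B := expR_gt0 _.
(* Then [eta / 2] is below [d k], so the circles stay in the disc where [phi < - lam], and below
   both [1] and [r^2 - 4 rho], so its square is below [r^2 - 4 rho]. *)
pose eta0 := Num.min (2 * d k) (2 * Num.min 1 (r ^+ 2 - 4 * rho)).
have eta00 : 0 < eta0 by rewrite /eta0 lt_min !mulr_gt0 // lt_min ltr01.
have Be : 0 <= B / eta0 by rewrite divr_ge0 // ltW.
pose n := (Num.bound (B / eta0)).+1.
have n0 : 0 < n%:R :> R by rewrite ltr0n.
pose eta := B / n%:R.
have eta_gt0 : 0 < eta by rewrite divr_gt0.
have etan : eta * n%:R = B by rewrite /eta divfK // gt_eqF.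
have eta_lt : eta < eta0.
  rewrite /eta ltr_pdivrMr // mulrC -ltr_pdivrMr //; apply: lt_trans (archi_boundP Be) _.
  by rewrite ltr_nat.
have := eta_lt; rewrite /eta0 lt_min => /andP[ed].
have -> : 2 * Num.min 1 (r ^+ 2 - 4 * rho) = Num.min (2 * 1) (2 * (r ^+ 2 - 4 * rho)).
  by rewrite minr_pMr.
rewrite lt_min => /andP[e1 e2].
have hmu : ((2 * C * eta * n%:R)%:E < mu (E k))%E by rewrite -mulrA etan.
have Eab : E k `<=` `[a, b]%classic by move=> u [/Iab].
have [s [ss sts sE]] := spaced_points C0 eta_gt0 muC (mE k) Eab hmu.
have : ln (n.+1%:R * eta) < 4 + ln (1 - 4 * rho) / 2 - (lam + N1) / m.
  apply: (@level_points _ phi z0 r rho m lam eta g s n) => //.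
  - by nra.
  - by move=> u /sE[/Irho].
  - move=> u z /sE[_ h] zu; apply/ltW; apply: h; rewrite zu ltr_pXn2r ?nnegrE ?(ltW (d0 _)) //; lra.
(* The right-hand side is [ln B], while [n.+1] points give [(n + 1) * eta = B + eta]. *)
rewrite ltNge => /negP; apply; rewrite -[X in X <= _]expRK -/B ler_ln ?posrE //.
  by rewrite -natr1; lra.
by rewrite mulr_gt0 // ltr0n.
Qed.

(** * Integrability *)

Lemma measurable_expeR (R : realType) : measurable_fun [set: \bar R] (@expeR R).
Proof.
apply: (measurability _ (ErealGenOInfty.measurableE R)).
move=> /= _ [_ [a ->]] <-; rewrite setTI preimage_itvoy.
have [a0|a0] := ltP a 0.
  have -> : [set x | (a%:E < expeR x)%E] = setT; last exact: measurableT.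
  by apply/seteqP; split => // x _ /=; apply: lt_le_trans (expeR_ge0 x); rewrite lte_fin.
have -> : [set x | (a%:E < expeR x)%E] = `]lne a%:E, +oo[%classic.
  apply/seteqP; split => x /=; rewrite in_itv /= andbT -{1}(@lneK R a%:E) ?lte_expeR //;
    by rewrite in_itv /= lee_fin a0 leey.
exact: emeasurable_itv.
Qed.

Lemma nneseries_geometric_le (R : realType) (c q : R) : 0 <= c -> 0 <= q < 1 ->
  (\sum_(k <oo) (c * q ^+ k)%:E <= (c / (1 - q))%:E)%E.
Proof.
move=> c0 /andP[q0 q1]; apply: lime_le.
  by apply: is_cvg_nneseries => k _ _; rewrite lee_fin mulr_ge0 // exprn_ge0.
apply: nearW => n; rewrite sumEFin lee_fin -mulr_sumr ler_wpM2l //.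
rewrite big_mkord -[leRHS]mul1r ler_pdivlMr; last by lra.
have := subrX1 q n; set S := \sum_(i < n) _ => h.
have := exprn_ge0 n q0; lra.
Qed.

(** The function is at most [exp 1] plus the sum over [k] of [exp (k + 2)] on the level set [E k].
    The integral of the [k]-th term is at most [K * exp 2 * exp (1 - p)^k], a convergent geometric
    series. *)
Lemma integrable_of_levels (R : realType) (mu : {measure set (measurableTypeR R) -> \bar R})
    (I : set (measurableTypeR R)) (f : measurableTypeR R -> \bar R) (K p : R) :
  measurable I -> (mu I < +oo)%E -> measurable_fun setT f -> 0 <= K -> 1 < p ->
  (forall lam, (mu (I `&` [set u | (f u < (- lam)%:E)%E]) <= (K * expR (- p * lam))%:E)%E) ->
  mu.-integrable I (fun u => expeR (- f u)).
Proof.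
move=> mI muI mf K0 p1 lev.
pose E k : set (measurableTypeR R) := I `&` [set u | (f u < (- k%:R)%:E)%E].
have mE k : measurable (E k).
  by apply: emeasurable_fun_infty_o => //; exact: measurable_funTS.
pose F k u : \bar R := ((expR (k%:R + 2))%:E * (\1_(E k) u)%:E)%E.
have mind k : measurable_fun I (fun u => (\1_(E k) u)%:E : \bar R).
  by apply/measurable_EFinP; apply: measurable_funTS; exact: measurable_indic.
have F0 k u : (0 <= F k u)%E.
  by rewrite mule_ge0 // lee_fin ?expR_ge0.
have mF k : measurable_fun I (F k).
  by apply: emeasurable_funM => //; exact: measurable_cst.
pose H u : \bar R := ((expR 1)%:E + \sum_(k <oo) F k u)%E.
have S0 u : (0 <= \sum_(k <oo) F k u)%E by apply: nneseries_ge0 => k _ _; exact: F0.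
have FS k u : (F k u <= \sum_(j <oo) F j u)%E.
  apply: le_trans (nneseries_lim_ge k.+1 _); last by move=> j _ _; exact: F0.
  by rewrite big_nat_recr //= leeDr // sume_ge0.
have big u A : I u -> 0 <= A -> (f u < (- A)%:E)%E -> ((expR (A + 1))%:E <= H u)%E.
  move=> Iu A0 fA; pose k := Num.truncn A.
  have /andP[k1 k2] := Num.Theory.truncn_itv A0.
  have Ek : E k u.
    by split => //=; apply: lt_le_trans fA _; rewrite lee_fin lerN2.
  apply: le_trans (_ : (F k u <= H u)%E); last first.
    by apply: le_trans (FS k u) _; rewrite leeDr // lee_fin expR_ge0.
  rewrite /F indicE mem_set // mule1 lee_fin ler_expR.
  by move: k2; rewrite -natr1 -/k; lra.
have dom u : I u -> (expeR (- f u) <= H u)%E.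
  move=> Iu; case E0 : (f u) => [x||].
  - rewrite [expeR _]/=; have [x1|x1] := leP (- x) 1.
      by apply: le_trans (_ : (expR 1)%:E <= _)%E; rewrite ?lee_fin ?ler_expR // leeDl.
    (* Shifting by one half makes the level inequality strict and still leaves [A + 1 >= - x]. *)
    have := big u (- x - 2^-1) Iu; rewrite E0 lte_fin => /(_ _ _) h.
    apply: le_trans (h _ _); [rewrite lee_fin ler_expR|..]; lra.
  - by rewrite /= adde_ge0 // lee_fin expR_ge0.
  - suff -> : H u = +oo%E by rewrite leey.
    apply/eqyP => A A0; apply: le_trans (big u A Iu (ltW A0) _); last by rewrite E0 ltNyr.
    by rewrite lee_fin; have := @expR_ge1Dx R (A + 1); lra.
apply/integrableP; split.
  apply: measurableT_comp; first exact: measurable_expeR.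
  by apply: measurableT_comp => //; exact: measurable_funTS.
apply: le_lt_trans (_ : (\int[mu]_(u in I) H u < +oo)%E).
  apply: ge0_le_integral => //.
  - apply: measurableT_comp => //; apply: measurableT_comp; first exact: measurable_expeR.
    by apply: measurableT_comp => //; exact: measurable_funTS.
  - apply: emeasurable_funD; first exact: measurable_cst.
    by apply: ge0_emeasurable_sum.
  - by move=> u Iu; rewrite gee0_abs ?expeR_ge0 //; exact: dom.
rewrite ge0_integralD //; last by apply: ge0_emeasurable_sum.
rewrite integral_cst // lte_add_pinfty //.
  by rewrite lte_mul_pinfty // ?lee_fin ?expR_ge0.
rewrite integral_nneseries //.
pose q := expR (1 - p).
have q1 : 0 <= q < 1 by rewrite expR_ge0 /= -expR0 ltr_expR; lra.
have Ke : 0 <= K * expR 2 by rewrite mulr_ge0 // expR_ge0.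
apply: le_lt_trans (_ : (\sum_(k <oo) (K * expR 2 * q ^+ k)%:E < +oo)%E).
  apply: lee_nneseries => k _; first by move=> _; exact: integral_ge0.
  rewrite ge0_integralZl //.
  rewrite integral_indic // setIidl; last by move=> u [].
  apply: le_trans (lee_wpmul2l _ (lev k%:R)) _; first by rewrite lee_fin expR_ge0.
  rewrite -EFinM lee_fin /q -expRM_natl mulrCA -mulrA -!expRD.
  by rewrite le_eqVlt; apply/orP; left; apply/eqP; congr (_ * expR _); ring.
apply: le_lt_trans (nneseries_geometric_le Ke q1) _.
exact: ltry.
Qed.

(** On [J k] the function is at least [K * 4^k / d] and the measure is at least [d / 4^k / 2], so
    each of infinitely many disjoint shells contributes at least [K / 2]. *)
Lemma not_integrable_inv (R : realType) (mu : {measure set (measurableTypeR R) -> \bar R})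
    (I : set (measurableTypeR R)) (F : measurableTypeR R -> \bar R) (t d K : R)
    (J : nat -> set (measurableTypeR R)) :
  0 < d -> 0 < K -> measurable I ->
  (forall u : R, I u -> u != t -> ((K / `|u - t|)%:E <= F u)%E) ->
  (forall k, [/\ measurable (J k), J k `<=` I & ((d / 4 ^+ k / 2)%:E <= mu (J k))%E]) ->
  (forall k u, J k u -> d / 4 ^+ k / 2 <= `|u - t| <= d / 4 ^+ k) ->
  ~ mu.-integrable I F.
Proof.
move=> d0 K0 mI hF hJ Jt /integrableP[mF intF].
pose e k := d / 4 ^+ k.
have e0 k : 0 < e k by rewrite divr_gt0 // exprn_gt0.
have mJ k : measurable (J k) by have [] := hJ k.
have JI k : J k `<=` I by have [] := hJ k.
have UI : \bigcup_k J k `<=` I by move=> u [k _ /JI].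
have mFa : measurable_fun I (fun u => `|F u|%E) by apply: measurableT_comp.
have muU : measurable (\bigcup_k J k) by exact: bigcup_measurable.
have tJ : trivIset setT J.
  (* The ratio [4] separates the closed shells; with ratio [2] neighbours could share an
     endpoint. *)
  apply/trivIsetP => i j _ _.
  wlog ij : i j / (i < j)%N.
    move=> W nij; have := nij; rewrite neq_ltn => /orP[ij|ji]; first exact: W.
    by rewrite setIC; apply: W => //; rewrite eq_sym.
  move=> _; rewrite -subset0 => u [/Jt /andP[h1 _] /Jt /andP[_ h2]].
  have : e j <= e i / 4.
    rewrite /e -mulrA -invfM -exprSr ler_pM2l // lef_pV2 ?posrE ?exprn_gt0 //.
    by rewrite ler_eXn2l // ltr1n.
  by have := e0 i; rewrite /e in h1 h2 *; lra.
have lb k : ((K / 2)%:E <= \int[mu]_(u in J k) `|F u|)%E.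
  have [_ _ muJ] := hJ k.
  apply: (@le_trans _ _ (\int[mu]_(u in J k) (cst (K / e k)%:E) u)%E).
    rewrite integral_cst //; apply: le_trans (lee_wpmul2l _ muJ); last first.
      by rewrite lee_fin divr_ge0 // ltW.
    rewrite -EFinM lee_fin -/(e k) le_eqVlt; apply/orP; left; apply/eqP.
    by field; rewrite gt_eqF.
  apply: ge0_le_integral => //.
  - by move=> u _; rewrite /cst lee_fin divr_ge0 // ltW.
  - exact: measurable_funS mFa.
  - move=> u Ju; have /andP[h1 h2] := Jt k u Ju.
    have u0 : 0 < `|u - t| by apply: lt_le_trans h1; rewrite -/(e k); have := e0 k; lra.
    have ut : u != t by rewrite -subr_eq0 -normr_gt0.
    apply: le_trans (lee_abs _); apply: le_trans (hF u (JI k u Ju) ut).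
    by rewrite /cst lee_fin ler_pM2l // lef_pV2 ?posrE.
have le n : ((n%:R * (K / 2))%:E <= \int[mu]_(u in I) `|F u|)%E.
  apply: (@le_trans _ _ (\int[mu]_(u in \bigcup_k J k) `|F u|)%E); last first.
    by apply: ge0_subset_integral.
  rewrite ge0_integral_bigcup //; last exact: measurable_funS mFa.
  apply: le_trans (nneseries_lim_ge n _); last by move=> k _ _; exact: integral_ge0.
  apply: (@le_trans _ _ (\sum_(0 <= i < n) (K / 2)%:E)%E); last first.
    by apply: lee_sum => i _; exact: lb.
  by rewrite sumEFin lee_fin sumr_const_nat subn0 mulr_natl.
suff : (\int[mu]_(u in I) `|F u| = +oo)%E by move=> E; rewrite E ltxx in intF.
apply/eqyP => A A0; apply: le_trans (le (Num.bound (A / (K / 2)))).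
have K2 : 0 < K / 2 by rewrite divr_gt0.
rewrite lee_fin -ler_pdivrMr //; apply/ltW/archi_boundP.
by rewrite divr_ge0 // ltW.
Qed.

(** * Extension of the curve to the whole line, and the equivalence *)

(** Nothing is known of [y] outside [[a, b]]. Composing it with this projection gives a Lipschitz
    function on the whole line that agrees with [y] on [[a, b]], so global continuity is
    available. *)
Definition clamp (R : realType) (a b x : R) : R := Num.max a (Num.min b x).

Lemma clamp_cases (R : realType) (a b x : R) : a < b ->
  [\/ x <= a /\ clamp a b x = a, a <= x <= b /\ clamp a b x = x |
     b <= x /\ clamp a b x = b].
Proof.
move=> ab; rewrite /clamp; have [bx|xb] := leP b x.
  by apply: Or33; split => //; apply: max_r; exact: ltW.
have [ax|xa] := leP a x; first by apply: Or32; rewrite (ltW xb).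
by apply: Or31; rewrite ltW.
Qed.

Lemma clamp_itv (R : realType) (a b x : R) : a < b -> a <= clamp a b x <= b.
Proof.
by move=> ab; case: (clamp_cases x ab) => -[+ ->]; rewrite ?lexx ?(ltW ab).
Qed.

Lemma clamp_dist (R : realType) (a b x x' : R) : a < b ->
  `|clamp a b x - clamp a b x'| <= `|x - x'|.
Proof.
move=> ab.
case: (clamp_cases x ab) => -[hx ->]; case: (clamp_cases x' ab) => -[hx' ->];
  rewrite ler_norml; have := ler_norm (x - x'); have := ler_norm (x' - x);
  rewrite distrC; set n := `|_|; try (move: hx => /andP[? ?]); try (move: hx' => /andP[? ?]);
  move=> ? ?; have : 0 <= n by exact: normr_ge0.
all: by move=> ?; apply/andP; split; lra.
Qed.

Lemma clamp_id (R : realType) (a b x : R) : a <= x <= b -> clamp a b x = x.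
Proof. by move=> /andP[ax xb]; rewrite /clamp (min_r xb) (max_r ax). Qed.

Lemma graph_continuous (R : realType) (Y : R -> R) (L : R) :
  0 <= L -> (forall x x', `|Y x - Y x'| <= L * `|x - x'|) -> continuous (fun x => (x, Y x)).
Proof.
move=> L0 lip x; apply: (@cvg_pair _ _ _ _ (nbhs x) (nbhs (Y x))); first exact: cvg_id.
apply/cvgrPdist_lt => e e0; have L1 : 0 < L + 1 by lra.
near=> u.
apply: le_lt_trans (lip _ _) _.
have : `|x - u| < e / (L + 1).
  by near: u; apply: (@cvgr_dist_lt _ _ _ (nbhs x)); [exact: cvg_id|exact: (divr_gt0 e0 L1)].
rewrite ltr_pdivlMr //; have := normr_ge0 (x - u); nra.
Unshelve. all: by end_near. Qed.

(** Take [m] halfway between [D / (- ln r)] and [1]. At [rho = 0] the last inequality reads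
    [D < m * (- ln r)] and is strict, so by continuity it persists for small [rho > 0]. *)
Lemma slope_perturb (R : realType) (D r : R) : 0 < r < 1 -> 0 <= D -> D < - ln r ->
  exists m rho, [/\ 0 < m < 1, 0 < rho, 0 < r ^+ 2 - 4 * rho &
    D < m / 2 * (ln (1 - 4 * rho) - ln (r ^+ 2 + 6 * rho))].
Proof.
move=> /andP[r0 r1] D0 Dl; set l := - ln r in Dl.
have l0 : 0 < l by exact: le_lt_trans Dl.
have r2 : 0 < r ^+ 2 by rewrite exprn_gt0.
pose m := (D / l + 1) / 2.
have Dl1 : D / l < 1 by rewrite ltr_pdivrMr // mul1r.
have Dl0 : 0 <= D / l by rewrite divr_ge0 // ltW.
have m01 : 0 < m < 1 by rewrite /m; apply/andP; split; lra.
have Dm : D < m * l by rewrite -ltr_pdivrMr // /m; lra.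
exists m.
pose F (x : R) := m / 2 * (ln (1 - 4 * x) - ln (r ^+ 2 + 6 * x)).
have F0 : D < F 0.
  rewrite /F !mulr0 subr0 addr0 ln1 lnXn // -mulr_natl; move: Dm; rewrite /l; lra.
have cl (c k : R) : 0 < c -> {for 0, continuous (fun x : R => ln (c + k * x))}.
  move=> c0; apply: (@continuous_comp _ _ _ (fun x : R => c + k * x) (@ln R)).
    apply: cvgD; first exact: cvg_cst.
    by apply: cvgM; [exact: cvg_cst|exact: cvg_id].
  by apply: continuous_ln; rewrite mulr0 addr0.
have cF : {for 0, continuous F}.
  apply: cvgM; first exact: cvg_cst.
  apply: cvgB; last exact: cl.
  have -> : (fun x : R => ln (1 - 4 * x)) = (fun x => ln (1 + (- 4) * x)).
    by apply/funext => x; rewrite mulNr.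
  rewrite (_ : ln (1 - 4 * 0) = ln (1 + (- 4) * 0)); last by rewrite mulNr.
  by apply: cl.
have n1 : \forall x \near (0 : R), D < F x by exact: (cF _ (lt_nbhsr F0)).
have n2 : \forall x \near (0 : R), x < r ^+ 2 / 4 by apply: lt_nbhsl; lra.
have n3 : \forall x \near (0:R)^'+, D < F x /\ x < r ^+ 2 / 4.
  by apply: cvg_at_right_filter (@cvg_id _ _) _ _; apply: filterI.
have [x [/= x0 [x1 x2]]] := filter_ex (filterI (nbhs_right_gt (0 : R)) n3).
by exists x; split => //; lra.
Qed.

Theorem theorem2p12 (R : realType) (a b : R) (y : R -> R)
    (phi : R * R -> \bar R)
    (mu : {measure set (measurableTypeR R) -> \bar R}) (t : R) :
  (a < b)%R ->
  lipschitz_on_interval y a b ->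
  subharmonic phi ->
  ~ (forall z, phi z = -oo%E) ->
  arclength_measure y a b mu ->
  (a <= t <= b)%R ->
  ((lelong phi (t, y t) < 1)%E <->
   exists2 delta : R, (0 < delta)%R &
     mu.-integrable [set s | (a <= s <= b)%R /\ (`|s - t| < delta)%R]
       (fun s => expeR (- phi (s, y s)))).
Proof.
move=> ab [L lip] sphi nphi muE tab.
have [_ uphi _] := sphi.
have C0 : 0 < 1 + `|L| by rewrite ltr_wpDr.
have muC c d : a <= c -> c <= d -> d <= b ->
    (mu `[c, d]%classic <= ((1 + `|L|) * (d - c))%:E)%E.
  by move=> ac cd db; rewrite muE //; exact: arclen_le lip ac db.
have muc c d : a <= c -> c <= d -> d <= b -> ((d - c)%:E <= mu `[c, d]%classic)%E.
  by move=> ac cd db; rewrite muE //; exact: arclen_ge.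
pose Y x := y (clamp a b x); pose g x : R * R := (x, Y x).
have YE x : a <= x <= b -> Y x = y x by move=> xab; rewrite /Y clamp_id.
have lipY x x' : `|Y x - Y x'| <= `|L| * `|x - x'|.
  apply: le_trans (lip _ _ (clamp_itv _ ab) (clamp_itv _ ab)) _.
  apply: (@le_trans _ _ (`|L| * `|clamp a b x - clamp a b x'|)).
    by rewrite ler_wpM2r // ler_norm.
  by rewrite ler_wpM2l // clamp_dist.
have cg : continuous g := graph_continuous (normr_ge0 L) lipY.
pose I delta : set (measurableTypeR R) := [set s | a <= s <= b /\ `|s - t| < delta].
have mI delta : measurable (I delta).
  have -> : I delta = `[a, b]%classic `&` [set s | `|s - t| < delta].
    by apply/seteqP; split => u /=; rewrite in_itv.
  apply: measurableI; first exact: measurable_itv.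
  apply: open_measurable.
  apply: (@open_comp _ _ (fun s : R => `|s - t|) [set x | x < delta]); last exact: open_lt.
  move=> u _; apply: cvg_norm; apply: cvgB; [exact: cvg_id|exact: cvg_cst].
have Iab delta : I delta `<=` `[a, b]%classic by move=> u [uab _] /=; rewrite in_itv.
set z0 := (t, y t); set N1 := fine (circ_max phi z0 1).
split=> [/(lelong_lt1 sphi nphi)[r r01 sr]|[delta delta0 intf]].
  have /andP[r0 r1] := r01.
  have l0 : 0 < - ln r by rewrite oppr_gt0 ln_lt0.
  have := circ_slope_ge0 z0 sphi nphi r01.
  move: sr; rewrite /circ_slope ltr_pdivrMr // mul1r pmulr_lge0 ?invr_gt0 // => hD D0.
  have [m [rho [/andP[m0 m1] rho0 rr hm]]] := slope_perturb r01 D0 hD.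
  (* On this neighbourhood both coordinates of the curve stay within [rho] of those of [z0]. *)
  exists (rho / (1 + `|L|)); first exact: (divr_gt0 rho0 C0).
  set delta := rho / _.
  have Irho u : I delta u -> `|(g u).1 - z0.1| <= rho /\ `|(g u).2 - z0.2| <= rho.
    move=> [uab]; rewrite /delta ltr_pdivlMr // => ud.
    have := lipY u t; rewrite (YE t) // /= => hY.
    by have := normr_ge0 (u - t); have := normr_ge0 L; split; nra.
  have lev lam := @level_measure _ phi z0 r rho m lam a b (1 + `|L|) g mu (I delta) sphi nphi r01 rho0 m0 rr hm cg (fun=> erefl)
    (ltW C0) muC (mI delta) (@Iab delta) Irho.
  have gE : {in I delta, (fun s => expeR (- phi (g s))) =1 (fun s => expeR (- phi (s, y s)))}.
    by move=> u; rewrite inE => -[uab _]; rewrite /g YE.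
  apply: (eq_integrable (mI delta) _ _ gE).
  (* The level bound decays like [exp (- lam / m)], so the exponent is [m^-1 > 1]; the factor
     independent of [lam] becomes the constant. *)
  apply: (@integrable_of_levels _ mu (I delta) (phi \o g)
    (2 * (1 + `|L|) * expR (4 + ln (1 - 4 * rho) / 2 - N1 / m)) m^-1) => //.
  - apply: le_lt_trans (_ : (mu `[a, b]%classic < +oo)%E).
      by apply: le_measure; rewrite ?inE //; exact: measurable_itv.
    by apply: le_lt_trans (muC a b _ _ _) _; rewrite ?lexx ?ltry // ltW.
  - exact: usc_measurable.
  - by rewrite invf_gt1.
  - move=> lam; apply: le_trans (lev lam) _; rewrite lee_fin -/N1 -[leRHS]mulrA -expRD.
    rewrite le_eqVlt; apply/orP; left; apply/eqP; congr (_ * expR _).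
    by field; rewrite gt_eqF.
apply: contrapT => nu1.
(* The second bound keeps the curve inside the open unit disc about [z0], where [lelong_ge1]
   applies. *)
pose delta1 := Num.min delta (1 + `|L|)^-1.
have delta10 : 0 < delta1 by rewrite lt_min delta0 invr_gt0.
have intf1 : mu.-integrable (I delta1) (fun s => expeR (- phi (s, y s))).
  apply: (integrableS (mI delta) (mI delta1) _ intf).
  by move=> u [uab ud]; split => //; apply: lt_le_trans ud _; rewrite ge_min lexx.
(* From [phi <= N1 + ln ((1 + |L|) |u - t|)] along the curve, [exp (- phi) >= K / |u - t|]. *)
pose K := expR (- N1) / (1 + `|L|).
have K0 : 0 < K by rewrite divr_gt0 ?expR_gt0.
have hF (u : R) : I delta1 u -> u != t -> ((K / `|u - t|)%:E <= expeR (- phi (u, y u)))%E.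
  move=> [uab ud] ut; set v := `|u - t| in ud *.
  have v0 : 0 < v by rewrite normr_gt0 subr_eq0.
  have v1 : (1 + `|L|) * v < 1.
    rewrite mulrC -ltr_pdivlMr // mul1r; apply: lt_le_trans ud _.
    by rewrite ge_min lexx orbT.
  have Lv0 : 0 < (1 + `|L|) * v by rewrite mulr_gt0.
  have s1 : sqd (u, y u) z0 <= ((1 + `|L|) * v) ^+ 2.
    rewrite /sqd /= -[(u - t) ^+ 2]real_normK ?num_real // -/v.
    rewrite -[(y u - y t) ^+ 2]real_normK ?num_real //.
    have := lipY u t; rewrite !YE // -/v; set w := `|y u - y t| => hw.
    have w0 : 0 <= w := normr_ge0 _; have := normr_ge0 L; nra.
  have s0 : 0 < sqd (u, y u) z0.
    apply: lt_le_trans (_ : v ^+ 2 <= _); first by rewrite exprn_gt0.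
    by apply: sqd_ge_fst => //; exact: ltW.
  have s11 : 0 < sqd (u, y u) z0 < 1.
    by rewrite s0; apply: le_lt_trans s1 _; rewrite expr_lt1 // ltW.
  have hphi := lelong_ge1 sphi nphi nu1 s11.
  have : (phi (u, y u) <= (N1 + ln ((1 + `|L|) * v))%:E)%E.
    apply: le_trans hphi _; rewrite lee_fin lerD2l ler_pdivrMr // mulr_natr -lnXn //.
    by rewrite ler_ln ?posrE // exprn_gt0.
  have -> : K / v = expR (- (N1 + ln ((1 + `|L|) * v))).
    by rewrite opprD expRD expRN (expRN (ln _)) lnK ?posrE // /K expRN invfM mulrA.
  move=> h; apply: (@le_trans _ _ (expeR (- (N1 + ln ((1 + `|L|) * v))%:E)%E)) => //.
  by rewrite lee_expeR leeN2.
move: tab => /andP[ta tb].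
have dk (d : R) k : 0 < d -> 0 < d / 4 ^+ k <= d.
  move=> d0; have e1 : 1 <= 4 ^+ k :> R by rewrite exprn_ege1 // ler1n.
  have e0 : 0 < 4 ^+ k :> R by lra.
  apply/andP; split; first exact: divr_gt0.
  by rewrite ler_pdivrMr // ler_peMr // ltW.
(* At an endpoint only one side of [t] belongs to the interval: shells go to the right if [t < b],
   otherwise to the left. In both cases [d] keeps them in [[a, b]] and within [delta1] of [t]. *)
have [tltb|tgeb] := ltP t b.
  pose d := Num.min (b - t) (delta1 / 2).
  have d0 : 0 < d by rewrite lt_min; apply/andP; split; lra.
  have db : d <= b - t by rewrite ge_min lexx.
  have dd : d < delta1.
    by apply: (@le_lt_trans _ _ (delta1 / 2)); [rewrite ge_min lexx orbT|lra].
  pose J k : set (measurableTypeR R) := `[t + d / 4 ^+ k / 2, t + d / 4 ^+ k]%classic.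
  apply: (not_integrable_inv (J := J) d0 K0 (mI _) hF _ _ intf1).
    move=> k; have /andP[e0 ed] := dk d k d0; split; first exact: measurable_itv.
      move=> u; rewrite /J /= in_itv /= => /andP[h1 h2]; split; first by apply/andP; split; lra.
      by rewrite ger0_norm; lra.
    apply: le_trans (muc _ _ _ _ _); last 3 first.
    - by lra.
    - by lra.
    - by lra.
    by rewrite lee_fin; lra.
  move=> k u; have /andP[e0 ed] := dk d k d0.
  rewrite /J /= in_itv /= => /andP[h1 h2].
  by rewrite ger0_norm; [apply/andP; split|]; lra.
pose d := Num.min (t - a) (delta1 / 2).
have d0 : 0 < d by rewrite lt_min; apply/andP; split; lra.
have db : d <= t - a by rewrite ge_min lexx.
have dd : d < delta1.
  by apply: (@le_lt_trans _ _ (delta1 / 2)); [rewrite ge_min lexx orbT|lra].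
pose J k : set (measurableTypeR R) := `[t - d / 4 ^+ k, t - d / 4 ^+ k / 2]%classic.
apply: (not_integrable_inv (J := J) d0 K0 (mI _) hF _ _ intf1).
  move=> k; have /andP[e0 ed] := dk d k d0; split; first exact: measurable_itv.
    move=> u; rewrite /J /= in_itv /= => /andP[h1 h2]; split; first by apply/andP; split; lra.
    by rewrite ler0_norm; lra.
  apply: le_trans (muc _ _ _ _ _); last 3 first.
  - by lra.
  - by lra.
  - by lra.
  by rewrite lee_fin; lra.
move=> k u; have /andP[e0 ed] := dk d k d0.
rewrite /J /= in_itv /= => /andP[h1 h2].
by rewrite ler0_norm; [apply/andP; split|]; lra.
Qed.
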